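(* Let $\lambda>0$ and $t\in\mathbb{R}$ be fixed, and let $\alpha_n=\alpha_n(t)$, $\beta_n=\beta_n(t)$ be the recurrence coefficients of the monic orthogonal polynomials with respect to $w(x;t)=x^\lambda e^{-x^2+tx}$ on $(0,\infty)$. Then, as $n\to\infty$, $$\begin{aligned}\alpha_n=&\ \sqrt{\frac{2n}{3}}+\frac{t}{6}+\frac{t^2+12(1+\lambda)}{24\sqrt{6n}}-\frac{t^4+24t^2(1+\lambda)-48(6\lambda^2-6\lambda-5)}{2304\sqrt{6}\,n^{3/2}}+\frac{t(9\lambda^2-2)}{144n^2}\\&+\frac{t^6+36t^4(1+\lambda)+144t^2(66\lambda^2+6\lambda-13)-1728(8\lambda^3+6\lambda^2-5\lambda-3)}{110592\sqrt{6}\,n^{5/2}}\\&+\frac{t\left[t^2(27\lambda^2-7)-12(9\lambda^3+9\lambda^2-2\lambda-2)\right]}{1728n^3}+O(n^{-7/2}),\end{aligned}$$ $$\begin{aligned}\beta_n=&\ \frac{n}{6}+\frac{t\sqrt{n}}{6\sqrt{6}}+\frac{t^2+6\lambda}{72}+\frac{t(t^2+12\lambda)}{288\sqrt{6n}}+\frac{2-9\lambda^2}{144n}-\frac{t(t^4+24\lambda t^2+3168\lambda^2-816)}{27648\sqrt{6}\,n^{3/2}}\\&+\frac{t^2(7-27\lambda^2)+4\lambda(9\lambda^2-2)}{1152n^2}+\frac{t\left[t^6+36\lambda t^4-144t^2(246\lambda^2-61)+1728\lambda(64\lambda^2-17)\right]}{1327104\sqrt{6}\,n^{5/2}}+O(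n^{-3}).\end{aligned}$$
   Context: For $\lambda>0$ and $t\in\mathbb{R}$, let $w(x;t)=x^\lambda e^{-x^2+tx}$ for $x\in(0,\infty)$. $P_n(x;t)$ is the monic polynomial of degree $n$ in $x$ with $\int_0^\infty P_m(x;t)P_n(x;t)w(x;t)\,dx=h_n(t)\delta_{mn}$ for $m,n\ge 0$. The recurrence coefficients $\alpha_n(t),\beta_n(t)$ are defined by the three-term recurrence relation $xP_n(x;t)=P_{n+1}(x;t)+\alpha_n(t)P_n(x;t)+\beta_n(t)P_{n-1}(x;t)$ with $P_0=1$ and $\beta_0P_{-1}=0$; for $n\ge1$, $\beta_n=h_n/h_{n-1}$. *)

(* Defs.v *)
From HB Require Import structures.
From mathcomp Require Import all_boot all_order all_algebra.
From mathcomp Require Import all_classical all_reals all_analysis.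

Set Implicit Arguments.
Unset Strict Implicit.
Unset Printing Implicit Defensive.

Import Order.TTheory GRing.Theory Num.Theory.
Import numFieldNormedType.Exports.

Local Open Scope classical_set_scope.
Local Open Scope ring_scope.

Definition semiclassical_laguerre_weight (R : realType) (lam t x : R) : R :=
  x `^ lam * expR (- x ^+ 2 + t * x).

Definition monic_orthogonal_polynomials (R : realType) (w : R -> R)
    (P : nat -> {poly R}) (h : nat -> R) : Prop :=
  (forall n, P n \is monic /\ size (P n) = n.+1) /\
  (forall m n,
     (\int[lebesgue_measure]_(x in `]0%R, +oo[)
        ((P m).[x] * (P n).[x] * w x)%:E)%E
     = (if m == n then h n else 0)%:E).

(* The case n = 0 is separate because of the convention beta_0 P_{-1} = 0;
   the value [beta 0] is left free. *)
Definition recurrence_coefficients (R : realType) (P : nat -> {poly R})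
    (alpha beta : nat -> R) : Prop :=
  [/\ P 0%N = 1,
      'X * P 0%N = P 1%N + alpha 0%N *: P 0%N
    & forall n, 'X * P n.+1 =
        P n.+2 + alpha n.+1 *: P n.+1 + beta n.+1 *: P n].

(* In the two expansions below, large denominators are written as products
   because numerals are unary here:
   110592 = 48^3, 27648 = 12 * 48^2 and 1327104 = 12 * 48^3. *)

Definition alpha_expansion (R : realType) (lam t : R) (n : nat) : R :=
  let N : R := n%:R in
  Num.sqrt (2 * N / 3)
  + t / 6
  + (t ^+ 2 + 12 * (1 + lam)) / (24 * Num.sqrt (6 * N))
  - (t ^+ 4 + 24 * t ^+ 2 * (1 + lam)
       - 48 * (6 * lam ^+ 2 - 6 * lam - 5))
    / (2304 * Num.sqrt 6 * N `^ (3 / 2))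
  + t * (9 * lam ^+ 2 - 2) / (144 * N ^+ 2)
  + (t ^+ 6 + 36 * t ^+ 4 * (1 + lam)
       + 144 * t ^+ 2 * (66 * lam ^+ 2 + 6 * lam - 13)
       - 1728 * (8 * lam ^+ 3 + 6 * lam ^+ 2 - 5 * lam - 3))
    / (48 ^+ 3 * Num.sqrt 6 * N `^ (5 / 2))
  + t * (t ^+ 2 * (27 * lam ^+ 2 - 7)
           - 12 * (9 * lam ^+ 3 + 9 * lam ^+ 2 - 2 * lam - 2))
    / (1728 * N ^+ 3).

Definition beta_expansion (R : realType) (lam t : R) (n : nat) : R :=
  let N : R := n%:R in
  N / 6
  + t * Num.sqrt N / (6 * Num.sqrt 6)
  + (t ^+ 2 + 6 * lam) / 72
  + t * (t ^+ 2 + 12 * lam) / (288 * Num.sqrt (6 * N))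
  + (2 - 9 * lam ^+ 2) / (144 * N)
  - t * (t ^+ 4 + 24 * lam * t ^+ 2 + 3168 * lam ^+ 2 - 816)
    / (12 * 48 ^+ 2 * Num.sqrt 6 * N `^ (3 / 2))
  + (t ^+ 2 * (7 - 27 * lam ^+ 2) + 4 * lam * (9 * lam ^+ 2 - 2))
    / (1152 * N ^+ 2)
  + t * (t ^+ 6 + 36 * lam * t ^+ 4
           - 144 * t ^+ 2 * (246 * lam ^+ 2 - 61)
           + 1728 * lam * (64 * lam ^+ 2 - 17))
    / (12 * 48 ^+ 3 * Num.sqrt 6 * N `^ (5 / 2)).

(* Main.v *)
Require Import Defs.
From HB Require Import structures.
From mathcomp Require Import all_boot all_order all_algebra.
From mathcomp Require Import all_classical all_reals all_analysis.
From mathcomp Require Import measurable_realfun ring lra.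
Import Order.TTheory GRing.Theory Num.Theory.
Import numFieldNormedType.Exports.
Local Open Scope classical_set_scope.
Local Open Scope ring_scope.

(** Under x = y^2 the weight becomes the symmetric Freud weight
    |y|^(2 lam + 1) exp(- y^4 + t y^2), whose recurrence coefficients g_k solve
    the discrete Painleve equation
      g_k (g_(k-1) + g_k + g_(k+1) - t / 2) = (k + (2 lam + 1) [k odd]) / 4.
    With a_n = g_(2n) and b_n = g_(2n+1) one has alpha_n = a_n + b_n and
    beta_n = a_n b_(n-1).  Here a and b are obtained on the half-line itself,
    from the kernel polynomials K_n = (P_(n+1) + b_n P_n) / X, which are
    orthogonal for x w(x).  The only analytic input is the Pearson identity
    int (x p w)' = 0 ([moment_pearson]) and the positivity of the moments
    ([moment_gt0]).  Applied to P_(n+1) K_n and to K_n P_n, the identity gives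
    the two string equations ([string_eq_a], [string_eq_b]); positivity gives
    a_n > 0 and b_n > 0.

    In powers of xi = (6 n)^(-1/2) the string equations have a formal solution
    with leading coefficients 1/6 and all coefficients rational polynomials in
    t and 2 lam + 1.  Truncated after eight terms it satisfies the equations up
    to O(xi^6) ([order_residual_a], [order_residual_b]).  Why is it close to
    the true solution?  The errors e_n in a_n and f_n in b_n satisfy, for
    instance,
      e_n (a_n + S_n) = - a_n (f_(n-1) + f_n) + residual,
    where S_n is about 3 / (6 xi).  Dropping the positive neighbours of a_n in
    its string equation bounds a_n by about 1 / (sqrt 12 xi), so that
    a_n / (a_n + S_n) stays below 2/5: the two neighbouring errors enter with
    total weight less than 1.  A sequence subject to such a recursion either
    grows geometrically, which the crude bound e_n, f_n = O(1 / xi) excludes,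
    or is of the order of the forcing term ([order_xi_of_contraction]).  Hence
    e_n and f_n are O(n^(-7/2)) without any previous knowledge of the leading
    asymptotics ([order_max_error]), and the expansions of alpha and beta are
    read off from the formal solution. *)

(** * Moments of the weight *)

Lemma roots_finite (F : fieldType) (p : {poly F}) : p != 0 ->
  exists s : seq F, forall x, root p x -> x \in s.
Proof.
have [n le_p] := ubnP (size p); elim: n p le_p => // n IHn p le_p p_neq0.
have [[a /factor_theorem[q pE]]|noroot] := pselect (exists a, root p a); last first.
  by exists [::] => x px; case: noroot; exists x.
have q_neq0 : q != 0 by apply: contraNneq p_neq0 => q0; rewrite pE q0 mul0r.
have [|s sP] := IHn q _ q_neq0.
  by move: le_p; rewrite pE size_Mmonic ?monicXsubC// size_XsubC addn2 ltnS.
exists (a :: s) => x; rewrite pE rootM root_XsubC inE => /orP[/sP->|->] //.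
by rewrite orbT.
Qed.

Section Weight.
Variables (R : realType) (lam t : R).
Hypothesis lam_gt0 : 0 < lam.

Local Notation mu := (@lebesgue_measure R).
Local Notation w := (semiclassical_laguerre_weight lam t).

Lemma normr_horner_le_expR (p : {poly R}) :
  exists C k, 0 <= C /\ forall x, 0 <= x -> `|p.[x]| <= C * expR (k * x).
Proof.
elim/poly_ind: p => [|p c [C [k [C0 Hp]]]].
  by exists 0, 0; split=> // x _; rewrite horner0 normr0 mul0r.
exists (C + `|c|), (`|k| + 1); split=> [|x x0]; first by rewrite addr_ge0.
rewrite hornerMXaddC (le_trans (ler_normD _ _))// mulrDl lerD//.
  rewrite normrM (ger0_norm x0) mulrDl mul1r expRD mulrA.
  apply: ler_pM => //.
    apply: (le_trans (Hp _ x0)); rewrite ler_wpM2l// ler_expR ler_wpM2r//.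
    exact: ler_norm.
  by rewrite (le_trans _ (expR_ge1Dx _))// lerDr.
rewrite ler_peMr// -expR0 ler_expR mulr_ge0// addr_ge0//.
Qed.

Lemma weight_ge0 x : 0 <= w x.
Proof. by rewrite mulr_ge0 ?powR_ge0 ?expR_ge0. Qed.

Lemma weight_gt0 x : 0 < x -> 0 < w x.
Proof. by move=> x0; rewrite mulr_gt0 ?powR_gt0 ?expR_gt0. Qed.

Lemma weight0 : w 0 = 0.
Proof. by rewrite /semiclassical_laguerre_weight powR0 ?mul0r ?gt_eqF. Qed.

(** The bound ln x < x absorbs the power of x into the exponential. *)
Lemma weight_le_expR x : 0 <= x -> w x <= expR ((lam + t) * x - x ^+ 2).
Proof.
rewrite le_eqVlt => /predU1P[<-|x0]; first by rewrite weight0 expR_ge0.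
rewrite /semiclassical_laguerre_weight /powR gt_eqF// -expRD ler_expR.
have := ler_pM2l lam_gt0 (ln x) x; rewrite (ltW (ln_sublinear x0)) => /idP.
by move: (lam * ln x) => y Hy; nra.
Qed.

(** All integrability and decay at infinity below comes from this one
    majorant. *)
Lemma poly_weight_le_expRN (p : {poly R}) :
  exists C, 0 <= C /\ forall x, 0 <= x -> `|p.[x] * w x| <= C * expR (- x).
Proof.
have [C [k [C0 Hp]]] := normr_horner_le_expR p.
(* the summand 1 provides the factor exp(- x), and c x - x^2 <= c^2 *)
pose c := k + lam + t + 1.
exists (C * expR (c ^+ 2)); split=> [|x x0]; first by rewrite mulr_ge0 ?expR_ge0.
rewrite normrM (ger0_norm (weight_ge0 x)).
apply: le_trans (ler_pM _ (weight_ge0 x) (Hp x x0) (weight_le_expR x x0)) _ => //.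
rewrite -!mulrA ler_wpM2l// -!expRD ler_expR.
by have := sqr_ge0 (x - c); have := sqr_ge0 x; have := sqr_ge0 c; rewrite /c; nra.
Qed.

Lemma poly_weight_cvg0y (p : {poly R}) : (p.[x] * w x) @[x --> +oo] --> (0 : R).
Proof.
have [C [C0 Hp]] := poly_weight_le_expRN p.
apply: (@squeeze_cvgr _ _ _ _ (fun x => - (C * expR (- x))) (fun x => C * expR (- x))).
- near=> x; rewrite -ler_norml; apply: Hp.
  by near: x; exact: nbhs_pinfty_ge.
- rewrite -[X in _ --> X]oppr0; apply: cvgN.
  rewrite -[X in _ --> X](mulr0 C); apply: cvgMl_tmp; exact: cvgr_expR.
- rewrite -[X in _ --> X](mulr0 C); apply: cvgMl_tmp; exact: cvgr_expR.
Unshelve. all: by end_near. Qed.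

Lemma is_derive_weight (x : R) : 0 < x ->
  is_derive x 1 (fun y => y * w y) ((1 + lam + t * x - 2 * x ^+ 2) * w x).
Proof.
move=> x0; rewrite /semiclassical_laguerre_weight.
have H1 := is_derive1_powR lam x0.
have H2 : is_derive x 1 (fun y : R => - y ^+ 2 + t * y) (- (2 * x) + t).
  by apply: is_derive_eq; rewrite /GRing.scale /=; ring.
have H3 : is_derive x 1 (fun y : R => expR (- y ^+ 2 + t * y))
    ((- (2 * x) + t) * expR (- x ^+ 2 + t * x)).
  by apply: is_derive_eq; rewrite /GRing.scale /=; ring.
apply: is_derive_eq; rewrite /GRing.scale /=.
have <- : x * x `^ (lam - 1) = x `^ lam by rewrite mulr_powRB1// ltW.
by ring.
Qed.

Lemma continuous_weight (x : R) : 0 < x -> {for x, continuous (w : R -> R)}.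
Proof.
move=> x0; apply: differentiable_continuous.
apply/derivable1_diffP; rewrite /semiclassical_laguerre_weight.
apply: derivableM; last by [].
by apply: derivable_powR; rewrite in_itv/= x0.
Qed.

Lemma cvg_weight0 : w x @[x --> 0^'+] --> (0 : R).
Proof.
rewrite -[X in _ --> X](mul0r (expR (- 0 ^+ 2 + t * 0))).
apply: cvgM; first exact: powR_cvg0.
apply: (@cvg_at_right_filter _ _ (fun x : R => expR (- x ^+ 2 + t * x))).
apply: (@continuous_comp _ _ _ (fun x : R => - x ^+ 2 + t * x)); last exact: continuous_expR.
apply: cvgD; last exact: cvgMl_tmp.
by apply: cvgN; exact: exprn_continuous.
Qed.

Local Notation D := (`]0%R, +oo[%classic : set R).

Lemma measurable_poly_weight (p : {poly R}) :
  measurable_fun D (fun x => p.[x] * w x).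
Proof.
apply: measurable_funM; first exact: measurable_poly.
apply: measurable_funM.
  by apply: measurable_funS (measurable_powR lam).
apply: measurableT_comp; first exact: measurable_expR.
by apply: measurable_funD; [apply: measurableT_comp | apply: measurable_funM].
Qed.

Lemma integral_expRN C : 0 <= C ->
  (\int[mu]_(x in `[0%R, +oo[) (C * expR (- x))%:E)%E = C%:E.
Proof.
move=> C0; rewrite (@ge0_continuous_FTC2y _ _ (fun x => - (C * expR (- x))) _ 0).
- by rewrite oppr0 expR0 mulr1 sub0e EFinN oppeK.
- by move=> x _; rewrite mulr_ge0 ?expR_ge0.
- apply: continuous_subspaceT => x; apply: cvgMl_tmp.
  apply: (@continuous_comp _ _ _ (fun x : R => - x)); last exact: continuous_expR.
  exact: cvgN.
- rewrite -[X in _ --> X]oppr0; apply: cvgN.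
  rewrite -[X in _ --> X](mulr0 C); apply: cvgMl_tmp; exact: cvgr_expR.
- by [].
- apply: (@cvg_at_right_filter _ _ (fun x : R => - (C * expR (- x)))).
  apply: cvgN; apply: cvgMl_tmp.
  apply: (@continuous_comp _ _ _ (fun x : R => - x)); last exact: continuous_expR.
  exact: cvgN.
- move=> x _; rewrite derive1E.
  by rewrite derive_val /GRing.scale /=; ring.
Qed.

Lemma integrable_expRN C : 0 <= C ->
  mu.-integrable `[0%R, +oo[ (EFin \o (fun x => C * expR (- x))).
Proof.
move=> C0; apply/integrableP; split.
  apply/measurable_EFinP; apply: measurable_funM => //.
  apply: measurableT_comp; first exact: measurable_expR.
  exact: oppr_measurable.
rewrite [X in (X < _)%E](_ : _ = C%:E) ?ltry// -(integral_expRN C C0).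
by apply: eq_integral => x _; rewrite /= ger0_norm// mulr_ge0 ?expR_ge0.
Qed.

Lemma integrable_poly_weight (p : {poly R}) :
  mu.-integrable D (EFin \o (fun x => p.[x] * w x)).
Proof.
have [C [C0 Hp]] := poly_weight_le_expRN p.
apply: (@le_integrable _ _ R mu _ _ _ (EFin \o (fun x : R => C * expR (- x)))) => //.
- by apply/measurable_EFinP; exact: measurable_poly_weight.
- move=> x /=; rewrite in_itv/= andbT => x0; rewrite lee_fin.
  rewrite (le_trans (Hp _ (ltW x0)))// ler_norm//.
- apply: integrableS (integrable_expRN C C0) => //.
  by move=> x /=; rewrite !in_itv/= !andbT; exact: ltW.
Qed.

Definition moment (p : {poly R}) : R := \int[mu]_(x in D) (p.[x] * w x).

Lemma momentD (p q : {poly R}) : moment (p + q) = moment p + moment q.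
Proof.
rewrite /moment -RintegralD//; try exact: integrable_poly_weight.
by apply: eq_Rintegral => x _; rewrite hornerD mulrDl.
Qed.

Lemma momentZ c (p : {poly R}) : moment (c *: p) = c * moment p.
Proof.
rewrite /moment -RintegralZl//; try exact: integrable_poly_weight.
by apply: eq_Rintegral => x _; rewrite hornerZ -mulrA.
Qed.

(** If the integral vanished, the integrand would vanish almost everywhere, so
    the half-line would be covered by a null set and finitely many roots. *)
Lemma moment_gt0 (p : {poly R}) : p != 0 -> (forall x, 0 < x -> 0 <= p.[x]) -> 0 < moment p.
Proof.
move=> p_neq0 p_ge0.
have pw_ge0 x : D x -> 0 <= p.[x] * w x.
  by rewrite /= in_itv/= andbT => x0; rewrite mulr_ge0 ?p_ge0 ?weight_ge0.
rewrite lt_neqAle Rintegral_ge0 ?andbT//; apply/negP => /eqP/esym m0.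
have : (\int[mu]_(x in D) `|(p.[x] * w x)%:E| = 0)%E.
  transitivity (\int[mu]_(x in D) (p.[x] * w x)%:E)%E.
    by apply: eq_integral => x; rewrite inE => /pw_ge0 /= ?; rewrite ger0_norm.
  rewrite -[LHS]fineK; first by rewrite -[fine _]/(moment p) m0.
  by apply: integrable_fin_num => //; exact: integrable_poly_weight.
move/ae_eq_integral_abs => /(_ (measurable_itv _)).
case=> [|N [mN N0 sN]].
  by apply/measurable_EFinP; exact: measurable_poly_weight.
have [s sP] := roots_finite _ p p_neq0.
have s_count : countable ([set` s] : set R).
  by apply: finite_set_countable; exact: finite_seq.
have s_meas : measurable ([set` s] : set R).
  by apply: countable_measurable => //; exact: measurable_set1.
have D0 : mu D = 0.
  apply: (@subset_measure0 _ _ _ mu _ (N `|` [set` s])) => //.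
  - exact: measurableU.
  - move=> x Dx; have [px0|px] := boolP (root p x); first by right; exact: sP.
    left; apply: sN => /(_ Dx) /eqP; rewrite eqe mulf_eq0 (negPf (px : p.[x] != 0))/= gt_eqF//.
    by apply: weight_gt0; move: Dx; rewrite /= in_itv/= andbT.
  - exact: etrans (measureU0 mN s_meas (countable_lebesgue_measure0 s_count)) N0.
by move: D0; rewrite lebesgue_measure_itv/= ltry.
Qed.

(** The polynomial q with (x p w)' = q w. *)
Definition pearson (p : {poly R}) : {poly R} :=
  'X * p^`() + ((1 + lam)%:P + t *: 'X - 2 *: 'X^2) * p.

Lemma horner_pearson (p : {poly R}) x : (pearson p).[x] =
  x * p^`().[x] + (1 + lam + t * x - 2 * x ^+ 2) * p.[x].
Proof.
by rewrite /pearson !(hornerD, hornerN, hornerM, hornerX, hornerC, hornerZ, hornerXn).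
Qed.

Lemma is_derive_pearson (p : {poly R}) (x : R) : 0 < x ->
  is_derive x 1 (fun y => ('X * p).[y] * w y) ((pearson p).[x] * w x).
Proof.
move=> x0; have Hw := is_derive_weight x x0.
have Hp : is_derive x 1 (horner p) p^`().[x].
  by apply: DeriveDef; [exact: derivable_horner | rewrite -derive1E -derivE].
rewrite (_ : (fun y => ('X * p).[y] * w y) = (fun y => p.[y] * (y * w y))); last first.
  by apply/funext => y; rewrite hornerM hornerX mulrAC mulrC mulrA.
apply: is_derive_eq; rewrite horner_pearson /GRing.scale /=.
by move: (w x) => wx; ring.
Qed.

Lemma cvg_poly_weight0 (p : {poly R}) :
  p.[x] * w x @[x --> 0^'+] --> p.[0] * w 0.
Proof.
rewrite weight0; apply: cvgM; last exact: cvg_weight0.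
by apply: cvg_at_right_filter; exact: continuous_horner.
Qed.

(** The function x p(x) w(x) vanishes at 0 and at infinity.  Its derivative
    changes sign, whereas the fundamental theorem on a half-line is stated for
    nonnegative functions: adding the majorant C exp(-x) to the derivative
    repairs this, and contributes C to both sides. *)
Lemma moment_pearson (p : {poly R}) : moment (pearson p) = 0.
Proof.
have [C [C0 HC]] := poly_weight_le_expRN (pearson p).
have cexp (x : R) : {for x, continuous (fun x : R => C * expR (- x))}.
  apply: cvgMl_tmp; apply: (@continuous_comp _ _ _ (fun x : R => - x)); last exact: continuous_expR.
  exact: cvgN.
have intC := integrable_expRN C C0.
have subD : D `<=` `[0%R, +oo[.
  by move=> x /=; rewrite !in_itv/= !andbT; exact: ltW.
have intCD : mu.-integrable D (EFin \o (fun x => C * expR (- x))).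
  exact: integrableS intC.
have intq := integrable_poly_weight (pearson p).
pose f := fun x => (pearson p).[x] * w x + C * expR (- x).
pose F := fun x => ('X * p).[x] * w x - C * expR (- x).
have : \int[mu]_(x in `[0%R, +oo[) f x = 0 - F 0.
  apply: Rintegral_ge0_continuous_FTC2y.
  - move=> x x0; rewrite -lerBlDr sub0r.
    by have := HC _ x0; rewrite ler_norml => /andP[].
  - apply/continuous_within_itvcyP; split=> [x|].
      rewrite in_itv/= andbT => x0; apply: cvgD; last exact: cexp.
      apply: cvgM; first exact: continuous_horner.
      exact: continuous_weight.
    apply: cvgD; first exact: cvg_poly_weight0.
    by apply: cvg_at_right_filter; exact: cexp.
  - rewrite -[X in _ --> X]subr0; apply: cvgB; first exact: poly_weight_cvg0y.
    rewrite -[X in _ --> X](mulr0 C); apply: cvgMl_tmp; exact: cvgr_expR.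
  - move=> x x0; have ? := is_derive_pearson p x x0.
    exact: ex_derive.
  - apply: cvgB; first exact: cvg_poly_weight0.
    by apply: cvg_at_right_filter; exact: cexp.
  - move=> x; rewrite in_itv/= andbT => x0; rewrite derive1E.
    have ? := is_derive_pearson p x x0.
    by rewrite derive_val /f /GRing.scale /=; ring.
have intf : mu.-integrable D (EFin \o f).
  exact: (integrableD _ intq intCD).
rewrite -Rintegral_itv_obnd_cbnd// RintegralD// -/(moment _).
rewrite (Rintegral_itv_obnd_cbnd intCD).
rewrite /(\int[mu]_(x in `[0%R, +oo[) _) integral_expRN//=.
by rewrite /F hornerM hornerX mul0r oppr0 expR0; lra.
Qed.

End Weight.

(** * Kernel polynomials and the string equations *)

Section StringEquations.
Variables (R : realFieldType) (lam t : R) (L : {poly R} -> R).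
Hypothesis LD : forall p q, L (p + q) = L p + L q.
Hypothesis LZ : forall c p, L (c *: p) = c * L p.
Hypothesis L_gt0 : forall p : {poly R},
  p != 0 -> (forall x, 0 < x -> 0 <= p.[x]) -> 0 < L p.
Hypothesis L_pearson : forall p : {poly R},
  L ('X * p^`() + ((1 + lam)%:P + t *: 'X - 2 *: 'X^2) * p) = 0.

Variables (P : nat -> {poly R}) (h alpha beta : nat -> R).
Hypothesis P_monic : forall n, P n \is monic.
Hypothesis size_P : forall n, size (P n) = n.+1.
Hypothesis P_orth : forall m n, L (P m * P n) = if m == n then h n else 0.
Hypothesis P0 : P 0 = 1.
Hypothesis P_rec0 : 'X * P 0 = P 1 + alpha 0%N *: P 0.
Hypothesis P_rec : forall n,
  'X * P n.+1 = P n.+2 + alpha n.+1 *: P n.+1 + beta n.+1 *: P n.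

Lemma functional_0 : L 0 = 0.
Proof. by rewrite -(scale0r 0) LZ mul0r. Qed.

Lemma functional_opp p : L (- p) = - L p.
Proof. by rewrite -scaleN1r LZ mulN1r. Qed.

Lemma coef_P_n n : (P n)`_n = 1.
Proof. by have /monicP := P_monic n; rewrite lead_coefE size_P. Qed.

Lemma P_neq0 n : P n != 0.
Proof. exact: monic_neq0. Qed.

Lemma size_sub_lead (q : {poly R}) n :
  (size q <= n.+1)%N -> (size (q - q`_n *: P n)%R <= n)%N.
Proof.
move=> q_n; apply/leq_sizeP => j; rewrite leq_eqVlt => /predU1P[<-|n_j].
  by rewrite coefB coefZ coef_P_n mulr1 subrr.
rewrite coefB coefZ (nth_default _ (leq_trans q_n n_j)).
by rewrite [(P n)`_j]nth_default ?size_P// mulr0 subr0.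
Qed.

Lemma orth_lower n (q : {poly R}) : (size q <= n)%N -> L (P n * q) = 0.
Proof.
have [k] := ubnP (size q); elim: k q => // k IHk q q_k q_n.
case: (posnP (size q)) => [/eqP|q_gt0].
  by rewrite size_poly_eq0 => /eqP->; rewrite mulr0 functional_0.
set m := (size q).-1; have q_m : size q = m.+1 by rewrite prednK.
have := size_sub_lead q m; rewrite q_m leqnn => /(_ isT) r_m.
rewrite -[q](subrK (q`_m *: P m)) mulrDr LD -scalerAr LZ P_orth.
rewrite q_m in q_k q_n; rewrite gtn_eqF // mulr0 addr0.
by apply: IHk; [exact: leq_ltn_trans r_m _ | exact: leq_trans r_m (ltnW _)].
Qed.

(** Subtracting a multiple of [P n] lowers the degree of [q], and lower degrees
    are orthogonal to [P n]. *)
Lemma orth_lead n (q : {poly R}) : (size q <= n.+1)%N ->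
  L (P n * q) = q`_n * h n.
Proof.
move=> q_n; rewrite -[q in LHS](subrK (q`_n *: P n)) mulrDr LD.
by rewrite orth_lower ?size_sub_lead// -scalerAr LZ P_orth eqxx add0r.
Qed.

Lemma h_gt0 n : 0 < h n.
Proof.
have <- : L (P n * P n) = h n by rewrite P_orth eqxx.
apply: L_gt0 => [|x _]; first by rewrite mulf_neq0 ?P_neq0.
by rewrite hornerM -expr2 sqr_ge0.
Qed.

Lemma beta_h n : beta n.+1 * h n = h n.+1.
Proof.
have : L ('X * P n.+1 * P n) = beta n.+1 * h n.
  rewrite P_rec !mulrDl !LD -!scalerAl !LZ !P_orth eqxx.
  by rewrite !gtn_eqF// mulr0 !add0r.
rewrite -mulrA mulrCA orth_lead; last by rewrite mulrC size_mulX ?P_neq0// size_P.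
by rewrite coefXM /= coef_P_n mul1r.
Qed.

(** The value that makes P_(n+1) + b_n P_n vanish at 0, hence divisible
    by X. *)
Definition kernel_coef n : R := - (P n.+1).[0] / (P n).[0].
Definition kernel_poly n : {poly R} := (P n.+1 + kernel_coef n *: P n) %/ 'X.
Local Notation b := kernel_coef.
Local Notation K := kernel_poly.

Lemma kernel_polyE n : (P n).[0] != 0 -> 'X * K n = P n.+1 + b n *: P n.
Proof.
move=> Pn0; rewrite mulrC divpK//.
rewrite -['X]subr0 -polyC0 dvdp_XsubCl /root hornerD hornerZ /b.
by rewrite mulfVK// subrr.
Qed.

Lemma kernel_poly_lead n : (P n).[0] != 0 -> size (K n) = n.+1 /\ (K n)`_n = 1.
Proof.
move=> Pn0; have E := kernel_polyE n Pn0.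
have bP : (size (b n *: P n)%R <= n.+1)%N by rewrite (leq_trans (size_scale_leq _ _))// size_P.
have sz : size ('X * K n) = n.+2.
  by rewrite E size_polyDl size_P// ltnS.
have K0 : K n != 0 by apply: contra_eq_neq sz => ->; rewrite mulr0 size_poly0.
split; first by move: sz; rewrite mulrC size_mulX// => -[].
have := congr1 (fun q : {poly R} => q`_n.+1) E; rewrite coefXM/= => ->.
by rewrite coefD coef_P_n nth_default ?addr0.
Qed.

(** X K_n is a combination of P_(n+1) and P_n, so K_n is orthogonal to lower
    degrees for the functional q |-> L (X q), and b_n is the ratio of the two
    squared norms. *)
Lemma kernel_orth n (q : {poly R}) : (P n).[0] != 0 -> (size q <= n.+1)%N ->
  L ('X * K n * q) = q`_n * (b n * h n).
Proof.
move=> Pn0 q_n; rewrite kernel_polyE// mulrDl LD orth_lower// add0r.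
by rewrite -scalerAl LZ orth_lead// mulrCA.
Qed.

Lemma kernel_coef_gt0_of n : (P n).[0] != 0 -> 0 < b n.
Proof.
move=> Pn0; have [szK leadK] := kernel_poly_lead n Pn0.
rewrite -(pmulr_lgt0 _ (h_gt0 n)) -[X in 0 < X]mul1r -leadK.
rewrite -kernel_orth ?szK// -mulrA; apply: L_gt0 => [|x x0].
  by rewrite mulf_neq0 ?polyX_eq0// mulf_neq0// -size_poly_eq0 szK.
by rewrite !hornerM hornerX mulr_ge0 ?(ltW x0)// -expr2 sqr_ge0.
Qed.

(** Zeros of P_n lie in the open half-line.  Inductively: if P_n(0) is nonzero,
    b_n is defined and is a ratio of two positive norms, so
    P_(n+1)(0) = - b_n P_n(0) is nonzero. *)
Lemma P_at0_neq0 n : (P n).[0] != 0.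
Proof.
elim: n => [|n IHn]; first by rewrite P0 hornerC oner_eq0.
have := kernel_coef_gt0_of n IHn; apply: contraTneq => E.
by rewrite /b E oppr0 mul0r ltxx.
Qed.

Lemma kernel_coef_gt0 n : 0 < b n.
Proof. exact/kernel_coef_gt0_of/P_at0_neq0. Qed.

(** Together with [kernel_coef] this is the quotient-difference (LU)
    factorization of the Jacobi matrix. *)
Definition qd_coef n : R := if n is m.+1 then beta m.+1 / b m else 0.
Local Notation a := qd_coef.

Lemma beta_factor n : beta n.+1 = a n.+1 * b n.
Proof. by rewrite /a divfK// gt_eqF// kernel_coef_gt0. Qed.

Lemma qd_coef_gt0 n : 0 < a n.+1.
Proof.
rewrite divr_gt0 ?kernel_coef_gt0//.
by rewrite -(pmulr_lgt0 _ (h_gt0 n)) beta_h h_gt0.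
Qed.

(** The three-term recurrence evaluated at 0. *)
Lemma alpha_sum n : alpha n = a n + b n.
Proof.
case: n => [|n] /=; rewrite /b.
  have := congr1 (fun q : {poly R} => q.[0]) P_rec0.
  rewrite P0 /= !hornerE => E; rewrite divr1.
  lra.
have := congr1 (fun q : {poly R} => q.[0]) (P_rec n).
rewrite /= !(hornerM, hornerD, hornerZ, hornerX) mul0r => E.
have p1 := P_at0_neq0 n.+1; have p0 := P_at0_neq0 n.
apply: (mulIf p1); rewrite mulrDl /a /b.
suff -> : beta n.+1 / (- (P n.+1).[0] / (P n).[0]) * (P n.+1).[0] = - (beta n.+1 * (P n).[0]).
  by rewrite divfK//; lra.
by field; rewrite p0 p1.
Qed.

Lemma pearson_expand (f : {poly R}) :
  L ('X * f^`()) + (1 + lam) * L f + t * L ('X * f) = 2 * L ('X * ('X * f)).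
Proof.
apply/eqP; rewrite -subr_eq0; apply/eqP.
rewrite -[RHS](L_pearson f) !mulrDl !LD mul_polyC LZ -scalerAl LZ.
rewrite mulNr functional_opp -scalerAl LZ expr2 -mulrA; ring.
Qed.

Lemma kernel_P_moment n : L ('X * (K n * P n)) = b n * h n.
Proof.
by rewrite mulrA kernel_orth ?P_at0_neq0 ?size_P// coef_P_n mul1r.
Qed.

Lemma XPP_moment n : L ('X * P n * P n) = alpha n * h n.
Proof.
case: n => [|n].
  by rewrite P_rec0 mulrDl LD -scalerAl LZ !P_orth eqxx/= add0r.
rewrite P_rec !mulrDl !LD -!scalerAl !LZ !P_orth eqxx.
by rewrite gtn_eqF// ltn_eqF// mulr0 add0r addr0.
Qed.

Lemma XPSP_moment n : L ('X * P n.+1 * P n) = h n.+1.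
Proof.
rewrite -mulrA mulrCA orth_lead; last by rewrite mulrC size_mulX ?P_neq0// size_P.
by rewrite coefXM /= coef_P_n mul1r.
Qed.

(** Pearson identity for P_(n+1) K_n.  In L (X (P_(n+1) K_n)') only the term
    P_(n+1)' K_n survives, with leading coefficient n+1. *)
Lemma string_eq_a n :
  a n.+1 * (b n + a n.+1 + b n.+1 - t / 2) = n.+1%:R / 2.
Proof.
have p0 := P_at0_neq0 n; have [szK leadK] := kernel_poly_lead n p0.
have E := kernel_polyE n p0.
have h0 := h_gt0 n; have b0 := kernel_coef_gt0 n.
have := pearson_expand (P n.+1 * K n).
have -> : L (P n.+1 * K n) = 0 by rewrite orth_lower ?szK.
have -> : L ('X * (P n.+1 * K n)) = h n.+1.
  rewrite mulrCA orth_lead ?coefXM /= ?leadK ?mul1r//.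
  by rewrite mulrC size_mulX ?szK// -size_poly_eq0 szK.
have -> : L ('X * ('X * (P n.+1 * K n))) = (alpha n.+1 + b n) * h n.+1.
  rewrite (mulrCA 'X (P n.+1)) E (mulrDr (P n.+1)) mulrDr LD.
  rewrite [X in L X + _]mulrA XPP_moment -scalerAr -scalerAr LZ [X in _ * L X]mulrA XPSP_moment.
  by rewrite mulrDl.
have -> : L ('X * (P n.+1 * K n)^`()) = n.+1%:R * (b n * h n).
  rewrite derivM mulrDr LD addrC mulrCA orth_lower; last first.
    rewrite mulrC (leq_trans (size_mul_leq _ _))// size_polyX addn2 /= -szK.
    by rewrite lt_size_deriv// -size_poly_eq0 szK.
  rewrite add0r [_ * K n]mulrC (mulrA 'X) kernel_orth//; last first.
    by rewrite -ltnS -(size_P n.+1) lt_size_deriv// P_neq0.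
  by rewrite coef_deriv coef_P_n.
rewrite alpha_sum -beta_h beta_factor => e.
have h_neq0 : b n * h n != 0 by rewrite mulf_neq0 ?gt_eqF.
apply: (mulIf h_neq0); move: e; move: (a n.+1) (b n) (b n.+1) (h n) => x y z k e.
lra.
Qed.

(** Pearson identity for K_n P_n.  In L (X (K_n P_n)') only the term K_n' P_n
    survives, with leading coefficient n. *)
Lemma string_eq_b n :
  b n * (a n + b n + a n.+1 - t / 2) = (n.+1%:R + lam) / 2.
Proof.
have p0 := P_at0_neq0 n; have [szK leadK] := kernel_poly_lead n p0.
have E := kernel_polyE n p0.
have h0 := h_gt0 n; have b0 := kernel_coef_gt0 n.
have := pearson_expand (K n * P n).
have -> : L (K n * P n) = h n by rewrite mulrC orth_lead ?szK// leadK mul1r.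
rewrite kernel_P_moment.
have -> : L ('X * ('X * (K n * P n))) = h n.+1 + b n * (alpha n * h n).
  rewrite (mulrA 'X (K n)) E mulrDl mulrDr LD [X in L X + _]mulrA XPSP_moment.
  by rewrite -scalerAl -scalerAr LZ [X in _ * L X]mulrA XPP_moment.
have -> : L ('X * (K n * P n)^`()) = n%:R * h n.
  rewrite derivM mulrDr LD addrC mulrA kernel_orth//; last first.
    by rewrite (leq_trans (size_poly _ _))// size_P leqnSn.
  rewrite nth_default ?mul0r ?add0r; last first.
    by rewrite -ltnS -(size_P n) lt_size_deriv// P_neq0.
  rewrite mulrA mulrC orth_lead; last first.
    by rewrite (leq_trans (size_mul_leq _ _))// size_polyX /= -szK lt_size_deriv// -size_poly_eq0 szK.
  rewrite coefXM coef_deriv; case: n leadK {p0 szK E h0 b0} => [|m]/= leadK.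
    by [].
  by rewrite leadK.
rewrite alpha_sum -beta_h beta_factor => e.
apply: (mulIf (lt0r_neq0 h0)); move: e.
move: (a n.+1) (a n) (b n) (h n) => x y z k e.
have -> : n.+1%:R = n%:R + 1 :> R by rewrite -natr1.
lra.
Qed.

End StringEquations.

(** * Orders of magnitude in powers of (6 n)^(-1/2) *)

Section Orders.
Variable R : realType.
Implicit Types (f g : nat -> R) (p : {poly R}) (k : nat).

(** The factor 6 makes all coefficients of the expansions rational: the terms
    in sqrt(2 n / 3), sqrt(6 n) and sqrt 6 n^(3/2) are powers of [xi n] up to
    rational factors. *)
Definition xi (n : nat) : R := (Num.sqrt (6 * n%:R))^-1.

Definition order_xi k f : Prop :=
  exists C, \forall n \near \oo, `|f n| <= C * xi n ^+ k.

Lemma near_pos : \forall n \near \oo, (0 < n)%N.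
Proof. exact: nbhs_infty_gt. Qed.

Lemma xi_gt0 n : (0 < n)%N -> 0 < xi n.
Proof. by move=> n0; rewrite invr_gt0 sqrtr_gt0 mulr_gt0 ?ltr0n. Qed.

Lemma xi_ge0 n : 0 <= xi n.
Proof. by rewrite invr_ge0 sqrtr_ge0. Qed.

Lemma xi_sqr n : (0 < n)%N -> 6 * n%:R * xi n ^+ 2 = 1.
Proof.
move=> n0; rewrite exprVn sqr_sqrtr ?mulr_ge0// mulfV//.
by rewrite mulf_neq0 ?pnatr_eq0 -?lt0n.
Qed.

Lemma xi_le1 n : (0 < n)%N -> xi n <= 1.
Proof.
move=> n0; have x0 := xi_ge0 n; have := xi_sqr n n0.
have : 1 <= n%:R :> R by rewrite ler1n.
by move: (xi n) x0 (n%:R) => x x0 y y1 E; nra.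
Qed.

Lemma xi_small (e : R) : 0 < e -> \forall n \near \oo, xi n <= e.
Proof.
move=> e0; near=> n.
have n0 : (0 < n)%N by near: n; exact: near_pos.
have : (6 * e ^+ 2)^-1 <= n%:R by near: n; exact: nbhs_infty_ger.
have e2 : 0 < 6 * e ^+ 2 by rewrite mulr_gt0// exprn_gt0.
rewrite -[X in X <= _]mul1r ler_pdivrMr// => Ne.
have E := xi_sqr n n0; rewrite leNgt; apply/negP => ex.
have : e ^+ 2 < xi n ^+ 2 by rewrite ltr_pXn2r ?nnegrE ?xi_ge0 ?(ltW e0).
have : 0 < n%:R :> R by rewrite ltr0n.
move: Ne E; move: (n%:R) (xi n ^+ 2) => N y Ne E N0 ey.
have : N * e ^+ 2 < N * y by rewrite ltr_pM2l.
lra.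
Unshelve. all: by end_near. Qed.

Lemma order_xi_eq k f g :
  (\forall n \near \oo, f n = g n) -> order_xi k f -> order_xi k g.
Proof.
move=> fg [C fC]; exists C; near=> n.
by rewrite -(near fg n)//; near: n.
Unshelve. all: by end_near. Qed.

Lemma order_xi_le k f g : (\forall n \near \oo, `|f n| <= `|g n|) ->
  order_xi k g -> order_xi k f.
Proof.
move=> fg [C gC]; exists C; near=> n.
by apply: le_trans (near fg n _) (near gC n _).
Unshelve. all: by end_near. Qed.

Lemma order_xi_leq j k f : (j <= k)%N -> order_xi k f -> order_xi j f.
Proof.
move=> jk [C fC]; exists `|C|; near=> n.
have n0 : (0 < n)%N by near: n; exact: near_pos.
apply: (le_trans (near fC n _)) => //.
rewrite -(subnK jk) exprD mulrA ler_wpM2r ?exprn_ge0 ?xi_ge0//.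
apply: (le_trans (ler_norm _)); rewrite normrM ler_piMr//.
by rewrite ger0_norm ?exprn_ge0 ?xi_ge0// exprn_ile1 ?xi_ge0 ?xi_le1.
Unshelve. all: by end_near. Qed.

Lemma order_xiD k f g :
  order_xi k f -> order_xi k g -> order_xi k (fun n => f n + g n).
Proof.
move=> [C fC] [C' gC]; exists (C + C'); near=> n.
rewrite (le_trans (ler_normD _ _))// mulrDl lerD//; near: n => //.
Unshelve. all: by end_near. Qed.

Lemma order_xiM j k f g :
  order_xi j f -> order_xi k g -> order_xi (j + k) (fun n => f n * g n).
Proof.
move=> [C fC] [C' gC]; exists (C * C'); near=> n.
rewrite normrM exprD mulrACA ler_pM//; near: n => //.
Unshelve. all: by end_near. Qed.

Lemma order_xi_cst (c : R) : order_xi 0 (fun=> c).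
Proof. by exists `|c|; near=> n; rewrite expr0 mulr1. Unshelve. all: by end_near. Qed.

Lemma order_xiZ k (c : R) f : order_xi k f -> order_xi k (fun n => c * f n).
Proof. by move=> fk; rewrite -[k]add0n; apply: order_xiM => //; exact: order_xi_cst. Qed.

Lemma order_xiN k f : order_xi k f -> order_xi k (fun n => - f n).
Proof. by move=> [C fC]; exists C; near=> n; rewrite normrN; near: n. Unshelve. all: by end_near. Qed.

Lemma order_xiB k f g :
  order_xi k f -> order_xi k g -> order_xi k (fun n => f n - g n).
Proof. by move=> fk gk; apply: order_xiD => //; exact: order_xiN. Qed.

Lemma order_xi_xi k : order_xi k (fun n => xi n ^+ k).
Proof.
exists 1; near=> n.
by rewrite mul1r ger0_norm// exprn_ge0// xi_ge0.
Unshelve. all: by end_near. Qed.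

Lemma order_xiX m f : order_xi 0 f -> order_xi 0 (fun n => f n ^+ m).
Proof.
move=> f0; elim: m => [|m IHm]; first exact: order_xi_cst.
apply: (@order_xi_eq _ (fun n => f n * f n ^+ m)).
  by near=> n; rewrite exprS.
exact: (@order_xiM 0 0).
Unshelve. all: by end_near. Qed.

Lemma order_xi_horner p : order_xi 0 (fun n => p.[xi n]).
Proof.
elim/poly_ind: p => [|p c IHp].
  by apply: order_xi_eq (order_xi_cst 0); near=> n; rewrite horner0.
apply: (@order_xi_eq _ (fun n => p.[xi n] * xi n ^+ 1 + c)).
  by near=> n; rewrite hornerMXaddC.
apply: order_xiD; last exact: order_xi_cst.
apply: (@order_xi_leq _ 1) => //; apply: (@order_xiM 0 1) => //.
exact: order_xi_xi.
Unshelve. all: by end_near. Qed.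

Lemma order_xi_horner_coef k p :
  (forall i, (i < k)%N -> p`_i = 0) -> order_xi k (fun n => p.[xi n]).
Proof.
move=> p0; apply: (@order_xi_eq _ (fun n => (drop_poly k p).[xi n] * xi n ^+ k)).
  near=> n; rewrite -[p in RHS](poly_take_drop k) hornerD hornerM hornerXn.
  rewrite (_ : take_poly k p = 0) ?horner0 ?add0r//.
  by apply/polyP => i; rewrite coef_take_poly coef0; case: ifP => // /p0.
by apply: (@order_xiM 0 k); [exact: order_xi_horner | exact: order_xi_xi].
Unshelve. all: by end_near. Qed.

Lemma order_xi_div k f : order_xi k.+1 f -> order_xi k (fun n => (xi n)^-1 * f n).
Proof.
move=> [C fC]; exists C; near=> n.
have n0 : (0 < n)%N by near: n; exact: near_pos.
rewrite normrM normfV (ger0_norm (xi_ge0 n)) mulrC ler_pdivrMr ?xi_gt0//.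
by rewrite -mulrA -exprSr; near: n.
Unshelve. all: by end_near. Qed.

Lemma order_xi_small f (e : R) : 0 < e -> order_xi 1 f ->
  \forall n \near \oo, `|f n| <= e.
Proof.
move=> e0 [C fC]; near=> n; apply: (le_trans (near fC n _)) => //.
have C1 : 0 < `|C| + 1 by rewrite ltr_wpDl.
have : xi n <= e / (`|C| + 1).
  by near: n; apply: xi_small; rewrite divr_gt0.
rewrite ler_pdivlMr// expr1 => H; apply: le_trans H; rewrite mulrC ler_wpM2l ?xi_ge0//.
by rewrite (le_trans (ler_norm _))// lerDl.
Unshelve. all: by end_near. Qed.

End Orders.

(** * Recursions that contract *)

Section Comparison.
Variable R : realType.

(** Bernoulli gives (1 + h)^k >= k h; if (1 + h)^5 <= 4/3, the fifth power of
    this beats any quartic. *)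
Lemma geometric_gt_quartic (C D : R) (n : nat) : 0 < D -> 0 <= C ->
  exists k, C * ((n + k)%:R ^+ 4 + 1) < (4 / 3) ^+ k * D.
Proof.
move=> D0 C0.
have [h [h0 h5]] : exists h : R, 0 < h /\ (1 + h) ^+ 5 <= 4 / 3.
  by exists (1 / 20); split; [lra|rewrite !exprS expr0; lra].
have hD : 0 < h ^+ 5 * D by rewrite mulr_gt0// exprn_gt0.
pose k := (n + (Num.truncn (17 * C / (h ^+ 5 * D))).+1)%N.
have k1 : 1 <= k%:R :> R by rewrite ler1n /k addnS.
have kC : 17 * C < k%:R * (h ^+ 5 * D).
  rewrite -ltr_pdivrMr// (lt_le_trans (truncnS_gt _))//.
  by rewrite ler_nat leq_addl.
exists k.
have nk : (n + k)%:R <= 2 * k%:R :> R by rewrite natrD mulr2n mulrDl !mul1r lerD2r ler_nat leq_addr.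
have k4 : 1 <= k%:R ^+ 4 :> R by rewrite exprn_ege1.
apply: (@le_lt_trans _ _ (17 * C * k%:R ^+ 4)).
  have : (n + k)%:R ^+ 4 <= (2 * k%:R) ^+ 4 :> R by rewrite lerXn2r ?nnegrE ?mulr_ge0.
  rewrite exprMn; move: (_ ^+ 4) (k%:R ^+ 4) k4 => x y y1.
  rewrite !exprS expr0; nra.
have kD : (k%:R * h) ^+ 5 * D <= (4 / 3) ^+ k * D.
  rewrite ler_wpM2r ?(ltW D0)//.
  apply: (@le_trans _ _ (((1 + h) ^+ k) ^+ 5)).
    rewrite lerXn2r ?nnegrE ?exprn_ge0 ?mulr_ge0 ?addr_ge0 ?(ltW h0)//.
    elim: k {k1 kC nk k4} => [|k IH]; first by rewrite mul0r expr0.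
    have : 1 <= (1 + h) ^+ k by rewrite exprn_ege1// lerDl ltW.
    rewrite -natr1 exprS; move: IH; move: (k%:R) (_ ^+ k) => y z; nra.
  rewrite exprAC lerXn2r ?nnegrE ?exprn_ge0 ?addr_ge0 ?(ltW h0)//.
apply: lt_le_trans kD.
have -> : (k%:R * h) ^+ 5 * D = k%:R * (h ^+ 5 * D) * k%:R ^+ 4 by ring.
by rewrite ltr_pM2r// exprn_gt0// (lt_le_trans ltr01).
Qed.

(** Let D = v - 4 C, so that D n <= 3/4 max (D (n-1), D (n+1)).  At the first
    index m where v exceeds the claimed bound, D (m-1) < D m, so the maximum
    is attained on the right and D (m+1) >= 4/3 D m; this propagates, and D
    would grow geometrically. *)
Lemma bounded_of_contraction (v : nat -> R) (C B : R) (N : nat) :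
  0 <= C -> 0 <= B ->
  (forall n, (N < n)%N -> v n <= 3 / 4 * Num.max (v n.-1) (v n.+1) + C) ->
  (forall n, (N < n)%N -> v n <= B * n%:R ^+ 4) ->
  forall n, (N <= n)%N -> v n <= Num.max (v N) (4 * C).
Proof.
move=> C0 B0 v_contr v_growth n Nn; set V := Num.max _ _.
rewrite leNgt; apply/negP => Vvn.
have ex : exists m, (N <= m)%N && (V < v m) by exists n; rewrite Nn.
have [m /andP[Nm Vm] m_min] := ex_minnP ex.
have {}Nm : (N < m)%N.
  by rewrite ltn_neqAle Nm andbT; apply: contraTneq Vm => <-; rewrite -leNgt le_max lexx.
have Vm1 : v m.-1 <= V.
  rewrite leNgt; apply/negP => Vm1; have := m_min m.-1.
  have m0 := leq_ltn_trans (leq0n _) Nm.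
  by rewrite Vm1 andbT -ltnS -[(m <= _)%N]ltnS !prednK// Nm ltnn => /(_ isT).
have VC : 4 * C <= V by rewrite le_max lexx orbT.
pose D i := v i - 4 * C.
have Dm : 0 < D m by rewrite subr_gt0 (le_lt_trans VC).
have step k : (4 / 3) ^+ k * D m <= D (m + k)%N /\ v (m + k).-1 < v (m + k)%N.
  elim: k => [|k [IH1 IH2]].
    by rewrite addn0 expr0 mul1r; split=> //; exact: le_lt_trans Vm.
  rewrite addnS /=.
  have Dk : 0 < D (m + k)%N by apply: lt_le_trans IH1; rewrite mulr_gt0// exprn_gt0.
  have := v_contr (m + k)%N (leq_trans Nm (leq_addr _ _)).
  have -> : (4 / 3) ^+ k.+1 * D m = 4 / 3 * ((4 / 3) ^+ k * D m) by rewrite exprS mulrA.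
  move: IH1 IH2 Dk.
  move: ((4 / 3) ^+ k * D m) => w; rewrite /D.
  move: (v (m + k).-1) (v (m + k)%N) (v (m + k).+1) => x y z.
  case: (lerP x z) => xz IH1 IH2 Dk H.
    by split; lra.
  by split; lra.
have [k] := geometric_gt_quartic (B + 4 * C) (D m) m Dm (addr_ge0 B0 (mulr_ge0 (ler0n _ _) C0)).
rewrite ltNge => /negP; apply; apply: (le_trans (step k).1).
have := v_growth (m + k)%N (leq_trans Nm (leq_addr _ _)).
have : 0 <= (m + k)%:R ^+ 4 :> R by [].
rewrite /D; move: (v _) (_ ^+ 4) => x y; nra.
Qed.

End Comparison.

(** * Index shifts of truncated expansions *)

Arguments xi {R} n.
Arguments order_xi {R} k f.

Section Shift.
Variable R : realType.
Implicit Types (f g r : nat -> R) (p : {poly R}) (k : nat).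

Lemma xi_succ n : (0 < n)%N -> (xi n.+1 / xi n) ^+ 2 * (1 + 6 * xi n ^+ 2) = 1 :> R.
Proof.
move=> n0; have x0 := xi_gt0 R n n0; have E := xi_sqr R n n0.
have E1 := xi_sqr R n.+1 isT.
rewrite expr_div_n; have -> : 1 + 6 * xi n ^+ 2 = 6 * n.+1%:R * xi n ^+ 2 :> R.
  by rewrite -[n.+1%:R]natr1 mulrDr mulrDl E mulr1.
by rewrite -[RHS]E1; field; rewrite gt_eqF.
Qed.

Lemma xi_pred n : (1 < n)%N -> (xi n.-1 / xi n) ^+ 2 * (1 - 6 * xi n ^+ 2) = 1 :> R.
Proof.
case: n => // n; rewrite ltnS => n0; rewrite /=.
have x0 := xi_gt0 R n.+1 isT; have E := xi_sqr R n n0.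
have E1 := xi_sqr R n.+1 isT.
rewrite expr_div_n; have -> : 1 - 6 * xi n.+1 ^+ 2 = 6 * n%:R * xi n.+1 ^+ 2 :> R.
  by move: E1; rewrite -[n.+1%:R]natr1 mulrDr mulrDl mulr1 => E1; rewrite -[X in X - _]E1 addrK.
by rewrite -[RHS]E; field; rewrite gt_eqF.
Qed.

Lemma order_xi_sqr_root k f : order_xi k (fun n => f n ^+ 2 - 1) ->
  (\forall n \near \oo, 0 < f n) -> order_xi k (fun n => f n - 1).
Proof.
move=> f2 f0; apply: order_xi_le f2; near=> n.
have ? : 0 < f n by near: n.
rewrite (_ : f n ^+ 2 - 1 = (f n - 1) * (f n + 1)); last by ring.
by rewrite normrM ler_peMr// ger0_norm; lra.
Unshelve. all: by end_near. Qed.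

(** The sequence r stands for xi (n + 1) / xi n (with c = 6) or
    xi (n - 1) / xi n (with c = - 6), that is, for (1 + u)^(-1/2) with
    u = c xi^2. *)
Variables (c : R) (r : nat -> R).
Hypothesis r_gt0 : \forall n \near \oo, 0 < r n.
Hypothesis r_sqr : \forall n \near \oo, r n ^+ 2 * (1 + c * xi n ^+ 2) = 1.

Local Notation u n := (c * xi n ^+ 2).

Lemma order_u k : order_xi (2 * k) (fun n => u n ^+ k).
Proof.
apply: (@order_xi_eq _ _ (fun n => c ^+ k * xi n ^+ (2 * k))).
  by near=> n; rewrite exprMn exprM.
by apply: order_xiZ; exact: order_xi_xi.
Unshelve. all: by end_near. Qed.

Lemma order_poly_u p : order_xi 0 (fun n => p.[u n]).
Proof.
apply: (@order_xi_eq _ _ (fun n => (p \Po (c *: 'X^2)).[xi n])).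
  by near=> n; rewrite horner_comp hornerZ hornerXn.
exact: order_xi_horner.
Unshelve. all: by end_near. Qed.

Lemma ratio_bounded : order_xi 0 r.
Proof.
have u1 : \forall n \near \oo, `|u n| <= 3 / 4.
  apply: order_xi_small; first lra.
  by apply: (@order_xi_leq _ 1 2) => //; exact: (order_u 1).
exists 2; near=> n; rewrite expr0 mulr1.
have r0 : 0 < r n by near: n.
have : r n ^+ 2 * (1 + u n) = 1 by near: n.
have : `|u n| <= 3 / 4 by near: n.
rewrite ler_norml (ger0_norm (ltW r0)) => /andP[u_ge _].
move: (u n) (r n) r0 u_ge => y z z0 y1 E; nra.
Unshelve. all: by end_near. Qed.

Lemma ratio_sub1 : order_xi 2 (fun n => r n - 1).
Proof.
apply: order_xi_sqr_root => //.
apply: (@order_xi_eq _ _ (fun n => u n ^+ 1 * - r n ^+ 2)).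
  near=> n; have <- : r n ^+ 2 * (1 + u n) = 1 by near: n.
  by ring.
apply: (@order_xiM _ 2 0); first exact: (order_u 1).
by apply: order_xiN; apply: order_xiX; exact: ratio_bounded.
Unshelve. all: by end_near. Qed.

(** If T is the Taylor polynomial then (r - T) (r + T) (1 + u) =
    1 - T^2 (1 + u), which is divisible by u^4, and the factor
    (r + T) (1 + u) is at least 1/2 for large n. *)
Lemma ratio_taylor3 :
  order_xi 8 (fun n => r n - (1 - u n / 2 + 3 / 8 * u n ^+ 2 - 5 / 16 * u n ^+ 3)).
Proof.
pose T n := 1 - u n / 2 + 3 / 8 * u n ^+ 2 - 5 / 16 * u n ^+ 3.
have uS : \forall n \near \oo, `|u n| <= 1 / 4.
  apply: order_xi_small; first lra.
  by apply: (@order_xi_leq _ 1 2) => //; exact: (order_u 1).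
pose q : {poly R} := (35 / 64)%:P - (7 / 32) *: 'X + (35 / 256) *: 'X^2 - (25 / 256) *: 'X^3.
have H : order_xi 8 (fun n => 2 * (u n ^+ 4 * q.[u n])).
  by apply: order_xiZ; apply: (@order_xiM _ 8 0); [exact: (order_u 4) | exact: order_poly_u].
apply: order_xi_le H; near=> n.
have r0 : 0 < r n by near: n.
have E : r n ^+ 2 * (1 + u n) = 1 by near: n.
have uh : `|u n| <= 1 / 4 by near: n.
have -> : u n ^+ 4 * q.[u n] = (r n - T n) * ((r n + T n) * (1 + u n)).
  rewrite (_ : _ * (_ * _) = r n ^+ 2 * (1 + u n) - T n ^+ 2 * (1 + u n)); last by ring.
  rewrite E /q !(hornerD, hornerN, hornerC, hornerZ, hornerX, hornerXn) /T.
  by field.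
rewrite -/(T n) mulrCA normrM ler_peMr//.
have T0 : 3 / 4 <= T n.
  rewrite /T; move: uh; rewrite ler_norml => /andP[]; move: (u n) => y y1 y2.
  have y20 : 0 <= y ^+ 2 by rewrite sqr_ge0.
  have : y ^+ 3 <= 1 / 4 * y ^+ 2 by rewrite exprSr mulrC ler_wpM2r.
  lra.
move: uh; rewrite ler_norml => /andP[uh _].
rewrite ger0_norm; first by move: T0 uh r0; move: (T n) (u n) (r n) => x y z *; nra.
by move: T0 uh r0; move: (T n) (u n) (r n) => x y z *; nra.
Unshelve. all: by end_near. Qed.

Lemma ratioX_bounded m : order_xi 0 (fun n => r n ^+ m).
Proof. by apply: order_xiX; exact: ratio_bounded. Qed.

Lemma order_uX k m : (m <= 2 * k)%N -> order_xi m (fun n => u n ^+ k).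
Proof. by move=> mk; apply: order_xi_leq mk (order_u k). Qed.

(** Each further power of r reduces to r itself through r^2 (1 + u) = 1; it is
    expanded only as far as [order_shift_poly] requires. *)
Lemma ratioV_taylor : order_xi 8 (fun n =>
  (r n)^-1 - (1 + u n / 2 - u n ^+ 2 / 8 + u n ^+ 3 / 16)).
Proof.
apply: (@order_xi_eq _ _ (fun n => (1 + u n ^+ 1) * (r n -
   (1 - u n / 2 + 3 / 8 * u n ^+ 2 - 5 / 16 * u n ^+ 3)) + - (5 / 16) * u n ^+ 4)).
  near=> n; have E : r n ^+ 2 * (1 + u n) = 1 by near: n.
  have r0 : 0 < r n by near: n.
  have -> : (r n)^-1 = r n * (1 + u n).
    by apply: (mulfI (lt0r_neq0 r0)); rewrite mulfV ?gt_eqF// mulrA.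
  by field.
apply: order_xiD; last by apply: order_xiZ; exact: order_uX.
apply: (@order_xiM _ 0 8); last exact: ratio_taylor3.
by apply: order_xiD; [exact: order_xi_cst | exact: order_uX].
Unshelve. all: by end_near. Qed.

Lemma ratio_taylor2 : order_xi 6 (fun n => r n - (1 - u n / 2 + 3 / 8 * u n ^+ 2)).
Proof.
apply: (@order_xi_eq _ _ (fun n => (r n -
   (1 - u n / 2 + 3 / 8 * u n ^+ 2 - 5 / 16 * u n ^+ 3)) + - (5 / 16) * u n ^+ 3)).
  by near=> n; field.
apply: order_xiD; first by apply: order_xi_leq ratio_taylor3.
by apply: order_xiZ; exact: order_uX.
Unshelve. all: by end_near. Qed.

Lemma ratio_sqr_taylor : order_xi 6 (fun n => r n ^+ 2 - (1 - u n + u n ^+ 2)).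
Proof.
apply: (@order_xi_eq _ _ (fun n => - (u n ^+ 3) * r n ^+ 2)).
  near=> n; have E : r n ^+ 2 * (1 + u n) = 1 by near: n.
  transitivity (r n ^+ 2 - r n ^+ 2 * (1 + u n) * (1 - u n + u n ^+ 2)); first by ring.
  by rewrite E mul1r.
apply: (@order_xiM _ 6 0); last exact: ratioX_bounded.
by apply: order_xiN; exact: order_uX.
Unshelve. all: by end_near. Qed.

Lemma ratio_cube_taylor : order_xi 4 (fun n => r n ^+ 3 - (1 - 3 / 2 * u n)).
Proof.
apply: (@order_xi_eq _ _ (fun n => r n ^+ 2 *
    ((r n - (1 - u n / 2 + 3 / 8 * u n ^+ 2)) + 15 / 8 * u n ^+ 2))).
  near=> n; have E : r n ^+ 2 * (1 + u n) = 1 by near: n.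
  transitivity (r n ^+ 3 - r n ^+ 2 * (1 + u n) * (1 - 3 / 2 * u n)); first by field.
  by rewrite E mul1r.
apply: (@order_xiM _ 0 4); first exact: ratioX_bounded.
apply: order_xiD; first by apply: order_xi_leq ratio_taylor2.
by apply: order_xiZ; exact: order_uX.
Unshelve. all: by end_near. Qed.

Lemma ratio_exp4_taylor : order_xi 4 (fun n => r n ^+ 4 - (1 - 2 * u n)).
Proof.
apply: (@order_xi_eq _ _ (fun n => r n ^+ 4 * (3 * u n ^+ 2 + 2 * u n ^+ 3))).
  near=> n; have E : r n ^+ 2 * (1 + u n) = 1 by near: n.
  transitivity (r n ^+ 4 - (r n ^+ 2 * (1 + u n)) ^+ 2 * (1 - 2 * u n)); first by ring.
  by rewrite E expr1n mul1r.
apply: (@order_xiM _ 0 4); first exact: ratioX_bounded.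
by apply: order_xiD; apply: order_xiZ; exact: order_uX.
Unshelve. all: by end_near. Qed.

Lemma ratio_exp5_taylor : order_xi 2 (fun n => r n ^+ 5 - 1).
Proof.
apply: (@order_xi_eq _ _ (fun n => r n ^+ 4 * ((r n - 1) - (2 * u n ^+ 1 + u n ^+ 2)))).
  near=> n; have E : r n ^+ 2 * (1 + u n) = 1 by near: n.
  transitivity (r n ^+ 5 - (r n ^+ 2 * (1 + u n)) ^+ 2); first by ring.
  by rewrite E expr1n.
apply: (@order_xiM _ 0 2); first exact: ratioX_bounded.
apply: order_xiB; first exact: ratio_sub1.
by apply: order_xiD; [apply: order_xiZ|]; exact: order_uX.
Unshelve. all: by end_near. Qed.

Lemma ratio_exp6_taylor : order_xi 1 (fun n => r n ^+ 6 - 1).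
Proof.
apply: (@order_xi_eq _ _ (fun n => r n ^+ 6 * - (3 * u n ^+ 1 + 3 * u n ^+ 2 + u n ^+ 3))).
  near=> n; have E : r n ^+ 2 * (1 + u n) = 1 by near: n.
  transitivity (r n ^+ 6 - (r n ^+ 2 * (1 + u n)) ^+ 3); first by ring.
  by rewrite E expr1n.
apply: (@order_xiM _ 0 1); first exact: ratioX_bounded.
apply: order_xiN; apply: order_xiD; last exact: order_uX.
by apply: order_xiD; apply: order_xiZ; exact: order_uX.
Unshelve. all: by end_near. Qed.

(** The coefficients of the expansion in xi of xi * B(xi') / xi', where
    xi' = r xi is the value of xi at the shifted index: coefficient j of B is
    multiplied by (1 + c xi^2)^((1 - j) / 2), and terms from xi^8 on are
    dropped. *)
Definition shift_coefs (B : {poly R}) : seq R :=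
  [:: B`_0; B`_1; B`_2 + c / 2 * B`_0; B`_3;
      B`_4 - c / 2 * B`_2 - c ^+ 2 / 8 * B`_0;
      B`_5 - c * B`_3;
      B`_6 - 3 / 2 * c * B`_4 + 3 / 8 * c ^+ 2 * B`_2 + c ^+ 3 / 16 * B`_0;
      B`_7 - 2 * c * B`_5 + c ^+ 2 * B`_3].

Definition shift_poly (B : {poly R}) : {poly R} := Poly (shift_coefs B).

(** The difference is the sum over j of B_j xi^j (r^(j-1) - T_j), where T_j is
    the Taylor polynomial of r^(j-1) in u; for j = 1 it is zero. *)
Lemma order_shift_poly (B : {poly R}) : (size B <= 8)%N ->
  order_xi 8 (fun n => (r n)^-1 * B.[xi n * r n] - (shift_poly B).[xi n]).
Proof.
move=> sB; have sS : (size (shift_poly B) <= 8)%N.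
  exact: leq_trans (size_Poly _) _.
have M j k (d : nat -> R) : (8 <= j + k)%N -> order_xi k d ->
    order_xi 8 (fun n => B`_j * (xi n ^+ j * d n)).
  move=> jk dk; apply: order_xiZ; apply: order_xi_leq jk _.
  by apply: order_xiM => //; exact: order_xi_xi.
have := order_xiD _ _ _ _ (M 0%N 8%N _ isT ratioV_taylor)
  (order_xiD _ _ _ _ (M 2%N 6%N _ isT ratio_taylor2)
  (order_xiD _ _ _ _ (M 3%N 6%N _ isT ratio_sqr_taylor)
  (order_xiD _ _ _ _ (M 4%N 4%N _ isT ratio_cube_taylor)
  (order_xiD _ _ _ _ (M 5%N 4%N _ isT ratio_exp4_taylor)
  (order_xiD _ _ _ _ (M 6%N 2%N _ isT ratio_exp5_taylor) (M 7%N 1%N _ isT ratio_exp6_taylor)))))).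
apply: order_xi_eq; near=> n; have r0 : 0 < r n by near: n.
rewrite (horner_coef_wide _ sB) (horner_coef_wide _ sS).
rewrite !big_ord_recl !big_ord0 /= /bump /= !add1n !coef_Poly /=.
by field; rewrite gt_eqF.
Unshelve. all: by end_near. Qed.

End Shift.

(** * The formal solution of the string equations *)

Section Formal.
Variables (R : realType) (lam t : R).
Let c : R := 2 * lam + 1.

(** Coefficients of the formal solution a_n = (1 / xi) (A_0 + A_1 xi + ...),
    found by solving the string equations order by order: at order j they are
    a 2 x 2 linear system for A_j and B_j with matrix (4, 2; 2, 4) / 6. *)
Definition approx_a_coefs : seq R :=
  [:: 1 / 6;
      t / 12;
      (t ^+ 2 - 12 * c) / 48;
      - (3 * c * t) / 8;
      (- t ^+ 4 - 264 * c * t ^+ 2 + 288 * c ^+ 2 + 48) / 768;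
      (- (9 * c * t ^+ 3) + (27 * c ^+ 2 + 1) * t) / 32;
      (t ^+ 6 - 1476 * c * t ^+ 4 + 144 * (48 * c ^+ 2 - 1) * t ^+ 2
        - 1728 * c * (c ^+ 2 + 6)) / (12 * 512);
      (- (27 * c * t ^+ 5) + 2 * (81 * c ^+ 2 - 1) * t ^+ 3
        - 6 * c * (9 * c ^+ 2 + 125) * t) / 128].
Definition approx_a : {poly R} := Poly approx_a_coefs.

Definition approx_b_coefs : seq R :=
  [:: 1 / 6;
      t / 12;
      (t ^+ 2 + 24 * c + 12) / 48;
      3 * c * t / 8;
      (- t ^+ 4 + 24 * (10 * c - 1) * t ^+ 2
        - 48 * (3 * c ^+ 2 + 12 * c + 2)) / 768;
      (9 * c * t ^+ 3 - (9 * c ^+ 2 + 36 * c - 1) * t) / 32;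
      (t ^+ 6 + 36 * (42 * c + 1) * t ^+ 4
        - 144 * (15 * c ^+ 2 + 60 * c - 2) * t ^+ 2
        - 1728 * c * (c ^+ 2 - 3 * c - 11)) / (12 * 512);
      (27 * c * t ^+ 5 - 2 * (27 * c ^+ 2 + 108 * c + 1) * t ^+ 3
        - 6 * (27 * c ^+ 3 - 36 * c ^+ 2 - 193 * c + 4) * t) / 128].
Definition approx_b : {poly R} := Poly approx_b_coefs.

(** The first string equation for the formal solution, multiplied by xi^2: the
    right-hand side n / 2 becomes 1 / 12. *)
Definition residual_a : {poly R} :=
  approx_a * (shift_poly R (- 6) approx_b + approx_a + approx_b - (t / 2) *: 'X)
  - (1 / 12)%:P.

Definition residual_b : {poly R} :=
  approx_b * (approx_a + approx_b + shift_poly R 6 approx_a - (t / 2) *: 'X)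
  - (1 / 12)%:P - ((1 + lam) / 2) *: 'X^2.

Lemma coefM_nat (p q : {poly R}) i :
  (p * q)`_i = \sum_(0 <= j < i.+1) p`_j * q`_(i - j).
Proof. by rewrite coefM big_mkord. Qed.

(** A computation with explicit coefficients; the polynomials
    themselves are generalized first so that simplification does not unfold
    them. *)
Lemma residual_a_coef i : (i < 8)%N -> residual_a`_i = 0.
Proof.
rewrite /residual_a.
have EA := coef_Poly approx_a_coefs; have EB := coef_Poly approx_b_coefs.
have ES := coef_Poly (shift_coefs R (- 6) approx_b); move: ES.
rewrite -/(shift_poly R (- 6) approx_b) /shift_coefs !EB.
rewrite -/approx_a -/approx_b in EA EB *.
move: approx_a approx_b (shift_poly _ _ _) EA EB => A B S.
rewrite /approx_a_coefs /approx_b_coefs /=; move: c => d EA EB ES.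
rewrite coefB coefM_nat coefC => i8.
under eq_bigr do rewrite !(coefD, coefN, coefZ, coefX, EA, EB, ES).
by move: i8; case: i => [|[|[|[|[|[|[|[|i]]]]]]]] //= _; rewrite unlock /=; field.
Qed.

Lemma residual_b_coef i : (i < 8)%N -> residual_b`_i = 0.
Proof.
rewrite /residual_b (_ : (1 + lam) / 2 = (c + 1) / 4); last by rewrite /c; field.
have EA := coef_Poly approx_a_coefs; have EB := coef_Poly approx_b_coefs.
have ES := coef_Poly (shift_coefs R 6 approx_a); move: ES.
rewrite -/(shift_poly R 6 approx_a) /shift_coefs !EA.
rewrite -/approx_a -/approx_b in EA EB *.
move: approx_a approx_b (shift_poly _ _ _) EA EB => A B S.
rewrite /approx_a_coefs /approx_b_coefs /=; move: c => d EA EB ES.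
rewrite 2!coefB coefM_nat coefC coefZ coefXn => i8.
under eq_bigr do rewrite !(coefD, coefN, coefZ, coefX, EA, EB, ES).
by move: i8; case: i => [|[|[|[|[|[|[|[|i]]]]]]]] //= _; rewrite unlock /=; field.
Qed.

Lemma size_approx_a : (size approx_a <= 8)%N.
Proof. exact: leq_trans (size_Poly _) _. Qed.

Lemma size_approx_b : (size approx_b <= 8)%N.
Proof. exact: leq_trans (size_Poly _) _. Qed.

(** Coefficients of beta_n as a series in xi, with leading factor xi^(-2). *)
Definition beta_poly_coefs : seq R :=
  [:: 1 / 36; t / 36; (t ^+ 2 + 6 * lam) / 72; t * (t ^+ 2 + 12 * lam) / 288;
      (2 - 9 * lam ^+ 2) / 24;
      - (t * (t ^+ 4 + 24 * lam * t ^+ 2 + 3168 * lam ^+ 2 - 816)) / (2 * 48 ^+ 2);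
      (t ^+ 2 * (7 - 27 * lam ^+ 2) + 4 * lam * (9 * lam ^+ 2 - 2)) / 32;
      t * (t ^+ 6 + 36 * lam * t ^+ 4
           - 144 * t ^+ 2 * (246 * lam ^+ 2 - 61)
           + 1728 * lam * (64 * lam ^+ 2 - 17)) / (16 * 48 ^+ 2)].
Definition beta_poly : {poly R} := Poly beta_poly_coefs.

Lemma beta_poly_coef i : (i < 8)%N ->
  (approx_a * shift_poly R (- 6) approx_b - beta_poly)`_i = 0.
Proof.
have EA := coef_Poly approx_a_coefs; have EB := coef_Poly approx_b_coefs.
have EC := coef_Poly beta_poly_coefs.
have ES := coef_Poly (shift_coefs R (- 6) approx_b); move: ES.
rewrite -/(shift_poly R (- 6) approx_b) /shift_coefs !EB.
rewrite -/approx_a -/approx_b -/beta_poly in EA EB EC *.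
move: approx_a approx_b beta_poly (shift_poly _ _ _) EA EB EC => A B C S.
rewrite /approx_a_coefs /approx_b_coefs /beta_poly_coefs /c /= => EA EB EC ES.
rewrite coefB coefM_nat EC => i8; under eq_bigr do rewrite EA ES.
by move: i8; case: i => [|[|[|[|[|[|[|[|i]]]]]]]] //= _; rewrite unlock /=; field.
Qed.

(** Coefficients of alpha_n as a series in xi, with leading factor xi^(-1); the
    zero is the absent term in 1 / n. *)
Definition alpha_poly_coefs : seq R :=
  [:: 1 / 3; t / 6; (t ^+ 2 + 12 * (1 + lam)) / 24; 0;
      - (t ^+ 4 + 24 * t ^+ 2 * (1 + lam)
       - 48 * (6 * lam ^+ 2 - 6 * lam - 5)) / 384;
      t * (9 * lam ^+ 2 - 2) / 4;
      (t ^+ 6 + 36 * t ^+ 4 * (1 + lam)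
       + 144 * t ^+ 2 * (66 * lam ^+ 2 + 6 * lam - 13)
       - 1728 * (8 * lam ^+ 3 + 6 * lam ^+ 2 - 5 * lam - 3)) / (64 * 48);
      t * (t ^+ 2 * (27 * lam ^+ 2 - 7)
           - 12 * (9 * lam ^+ 3 + 9 * lam ^+ 2 - 2 * lam - 2)) / 8].
Definition alpha_poly : {poly R} := Poly alpha_poly_coefs.

Lemma alpha_polyE : approx_a + approx_b = alpha_poly.
Proof.
apply/polyP => i; rewrite coefD !coef_Poly /alpha_poly_coefs /approx_a_coefs /approx_b_coefs /c.
by case: i => [|[|[|[|[|[|[|[|i]]]]]]]] /=; rewrite ?nth_nil; field.
Qed.

Lemma powR_half (x : R) k : 0 < x -> x `^ (k.*2.+1%:R / 2) = x ^+ k * Num.sqrt x.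
Proof.
move=> x0; have -> : k.*2.+1%:R / 2 = k%:R + 2^-1 :> R.
  by rewrite -addn1 -mul2n natrD natrM; field.
by rewrite powRD ?gt_eqF ?implybT// powR_mulrn ?powR12_sqrt// ltW.
Qed.

Lemma alpha_expansionE n : (0 < n)%N ->
  alpha_expansion lam t n = (xi n)^-1 * alpha_poly.[xi n].
Proof.
move=> n0; rewrite /alpha_expansion /xi invrK.
have N0 : 0 < n%:R :> R by rewrite ltr0n.
rewrite (@powR_half _ 1) // (@powR_half _ 2) //.
rewrite /alpha_poly horner_Poly /=; move: (n%:R) N0 => N N0.
have q0 : 0 < Num.sqrt 6 :> R by rewrite sqrtr_gt0.
have sE : Num.sqrt (6 * N) = Num.sqrt 6 * Num.sqrt N by rewrite sqrtrM.
have s0 : 0 < Num.sqrt (6 * N) by rewrite sqrtr_gt0 mulr_gt0.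
have -> : Num.sqrt N = Num.sqrt (6 * N) / Num.sqrt 6.
  by rewrite sE mulrAC mulfV ?mul1r// gt_eqF.
have NE : N = Num.sqrt (6 * N) ^+ 2 / 6.
  by rewrite sqr_sqrtr ?mulr_ge0 ?ltW//; field.
have -> : Num.sqrt (2 * N / 3) = Num.sqrt (6 * N) / 3.
  rewrite (_ : 2 * N / 3 = (Num.sqrt (6 * N) / 3) ^+ 2); last first.
    by rewrite expr_div_n sqr_sqrtr ?mulr_ge0 ?ltW//; field.
  by rewrite sqrtr_sqr ger0_norm// divr_ge0// ltW.
move: (Num.sqrt (6 * N)) (Num.sqrt 6) NE s0 q0 {sE} => s q -> s0 q0.
by field; rewrite !gt_eqF.
Qed.

Lemma beta_expansionE n : (0 < n)%N ->
  beta_expansion lam t n = (xi n)^- 2 * beta_poly.[xi n].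
Proof.
move=> n0; rewrite /beta_expansion /xi exprVn invrK.
have N0 : 0 < n%:R :> R by rewrite ltr0n.
rewrite (@powR_half _ 1) // (@powR_half _ 2) //.
rewrite /beta_poly horner_Poly /=; move: (n%:R) N0 => N N0.
have q0 : 0 < Num.sqrt 6 :> R by rewrite sqrtr_gt0.
have sE : Num.sqrt (6 * N) = Num.sqrt 6 * Num.sqrt N by rewrite sqrtrM.
have s0 : 0 < Num.sqrt (6 * N) by rewrite sqrtr_gt0 mulr_gt0.
have NE : N = Num.sqrt (6 * N) ^+ 2 / 6.
  by rewrite sqr_sqrtr ?mulr_ge0 ?ltW//; field.
have -> : t * Num.sqrt N / (6 * Num.sqrt 6) = t * Num.sqrt (6 * N) / 36.
  have q2 : Num.sqrt 6 ^+ 2 = 6 :> R by rewrite sqr_sqrtr.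
  have -> : 36 = 6 * Num.sqrt 6 ^+ 2 :> R by rewrite q2; ring.
  by rewrite sE; field; rewrite gt_eqF.
have -> : Num.sqrt N = Num.sqrt (6 * N) / Num.sqrt 6.
  by rewrite sE mulrAC mulfV ?mul1r// gt_eqF.
move: (Num.sqrt (6 * N)) (Num.sqrt 6) NE s0 q0 {sE} => s q -> s0 q0.
by field; rewrite !gt_eqF.
Qed.

End Formal.

(** * Contraction weighted by powers of n *)

Section Contraction.
Variable R : realType.

Lemma xi_pred_le : \forall n \near \oo, xi n.-1 <= 101 / 100 * xi n :> R.
Proof.
have H : order_xi 2 (fun n => (xi n.-1 / xi n - 1 : R)).
  apply: (@ratio_sub1 R (- 6) (fun n => xi n.-1 / xi n)).
    near=> n; rewrite divr_gt0 ?xi_gt0//; first by rewrite -subn1 subn_gt0; near: n; exact: nbhs_infty_gt.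
    by near: n; exact: near_pos.
  near=> n; rewrite mulNr; apply: xi_pred.
  by near: n; exact: nbhs_infty_gt.
near=> n.
have n0 : (0 < n)%N by near: n; exact: near_pos.
have : `|xi n.-1 / xi n - 1 : R| <= 1 / 100.
  near: n; apply: order_xi_small; first lra.
  exact: order_xi_leq H.
have x0 := xi_gt0 R n n0.
rewrite ler_norml => /andP[_ h].
by rewrite -ler_pdivrMr//; lra.
Unshelve. all: by end_near. Qed.

(** Dividing by xi^7 changes the contraction factor 2/3 by (xi (n-1) / xi n)^7,
    which tends to 1, so that 3/4 is still available for large n. *)
Lemma order_xi_of_contraction (m : nat -> R) :
  (forall n, 0 <= m n) ->
  (exists C, \forall n \near \oo, xi n * m n <= C) ->
  (exists C, \forall n \near \oo,
     m n <= 2 / 3 * Num.max (m n.-1) (m n.+1) + C * xi n ^+ 7) ->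
  order_xi 7 m.
Proof.
move=> m_ge0 [B mB] [C mC].
pose v n := m n * (xi n)^-1 ^+ 7.
have [N [N0 HN]] : exists N, (0 < N)%N /\ forall n, (N <= n)%N ->
    [/\ xi n * m n <= B, m n <= 2 / 3 * Num.max (m n.-1) (m n.+1) + C * xi n ^+ 7
      & xi n.-1 <= 101 / 100 * xi n :> R].
  have : \forall n \near \oo, [/\ xi n * m n <= B,
      m n <= 2 / 3 * Num.max (m n.-1) (m n.+1) + C * xi n ^+ 7
      & xi n.-1 <= 101 / 100 * xi n :> R].
    by apply: filterS3 mB mC xi_pred_le => n h1 h2 h3; split.
  move=> [N _ HN]; exists N.+1; split=> // n Nn; apply: HN => /=; exact: ltnW.
have v_contr n : (N < n)%N -> v n <= 3 / 4 * Num.max (v n.-1) (v n.+1) + `|C|.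
  move=> Nn; have [_ h1 h2] := HN n (ltnW Nn).
  have n1 : (0 < n.-1)%N by rewrite -subn1 subn_gt0 (leq_ltn_trans N0).
  have n0 : (0 < n)%N := ltn_trans N0 Nn.
  have x0 := xi_gt0 R n n0; have x1 := xi_gt0 R _ n1; have x2 := xi_gt0 R n.+1 isT.
  have s0 : 0 <= (xi n)^-1 ^+ 7 :> R by rewrite exprn_ge0// invr_ge0 ltW.
  have w1 : m n.-1 * (xi n)^-1 ^+ 7 <= 9 / 8 * v n.-1.
    rewrite /v [leRHS]mulrCA ler_wpM2l//.
    have -> : 9 / 8 * (xi n.-1)^-1 ^+ 7 = 9 / 8 * (xi n / xi n.-1) ^+ 7 * (xi n)^-1 ^+ 7 :> R.
      by rewrite expr_div_n; field; rewrite !gt_eqF.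
    rewrite ler_peMl//.
    have : 100 / 101 <= xi n / xi n.-1 :> R.
      by rewrite ler_pdivlMr//; lra.
    move: (xi n / xi n.-1) => q q1.
    have : (100 / 101) ^+ 7 <= q ^+ 7 by rewrite lerXn2r// nnegrE; lra.
    by rewrite !exprS !expr0; lra.
  have w2 : m n.+1 * (xi n)^-1 ^+ 7 <= v n.+1.
    rewrite /v ler_wpM2l// lerXn2r ?nnegrE ?invr_ge0 ?(ltW x0) ?(ltW x2)//.
    rewrite lef_pV2 ?posrE// /xi lef_pV2 ?posrE ?sqrtr_gt0 ?mulr_gt0 ?ltr0n//.
    by rewrite ler_wsqrtr// ler_wpM2l// ler_nat.
  have h3 : v n <= (2 / 3 * Num.max (m n.-1) (m n.+1) + C * xi n ^+ 7) * (xi n)^-1 ^+ 7.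
    by rewrite /v ler_wpM2r.
  apply: (le_trans h3).
  have -> : (2 / 3 * Num.max (m n.-1) (m n.+1) + C * xi n ^+ 7) * (xi n)^-1 ^+ 7 =
      2 / 3 * (Num.max (m n.-1) (m n.+1) * (xi n)^-1 ^+ 7) + C.
    by field; rewrite gt_eqF.
  apply: lerD; last exact: ler_norm.
  rewrite maxr_pMl//.
  have v1 : 0 <= v n.-1 by rewrite /v mulr_ge0// exprn_ge0// invr_ge0 ltW.
  move: w1 w2 v1; move: (v n.-1) (v n.+1) (m n.-1 * _) (m n.+1 * _) => x y z w *.
  by case: (lerP x y) => ?; case: (lerP z w) => ?; lra.
have v_growth n : (N < n)%N -> v n <= (6 ^+ 4 * `|B|) * n%:R ^+ 4.
  move=> Nn; have [h1 _ _] := HN n (ltnW Nn).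
  have n0 : (0 < n)%N := ltn_trans N0 Nn.
  have x0 := xi_gt0 R n n0; have E := xi_sqr R n n0.
  have -> : v n = xi n * m n * (xi n)^-1 ^+ 8 by rewrite /v; field; rewrite gt_eqF.
  have n6 : 6 * n%:R = (xi n)^-1 ^+ 2 :> R.
    have x2 : xi n ^+ 2 != 0 :> R by rewrite gt_eqF// exprn_gt0.
    by apply: (mulIf x2); rewrite E exprVn mulVf.
  rewrite [leRHS]mulrAC -exprMn n6 -exprM [leRHS]mulrC.
  rewrite ler_wpM2r ?exprn_ge0 ?invr_ge0 ?(ltW x0)//.
  by apply: (le_trans h1); exact: ler_norm.
have := bounded_of_contraction R v `|C| (6 ^+ 4 * `|B|) N (normr_ge0 _) _ v_contr v_growth.
rewrite mulr_ge0// => /(_ isT).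
move: (Num.max _ _) => V vV; exists V; near=> n.
have Nn : (N <= n)%N by near: n; exact: nbhs_infty_ge.
have x0 := xi_gt0 R n (leq_trans N0 Nn).
rewrite ger0_norm// -ler_pdivrMr ?exprn_gt0// -exprVn.
exact: vV.
Unshelve. all: by end_near. Qed.

End Contraction.

(** * Distance to the formal solution *)

(** The equation gives |e| (y + S) <= |rho| + y (|p| + |q|), and
    y / (y + S) <= 0.3 / 0.79 < 2/5. *)
Lemma one_step_error (R : realFieldType) (x y e p q S rho : R) :
  0 < x -> 0 < y -> x * y <= 3 / 10 -> 49 / 100 <= x * S ->
  y * (p + e + q) + e * S = - rho ->
  `|e| <= 2 / 5 * (`|p| + `|q|) + 3 * (x * `|rho|).
Proof.
move=> x0 y0 xy xS E.
have H : `|e| * (x * y + x * S) <= x * `|rho| + (x * y) * (`|p| + `|q|).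
  have S0 : 0 <= S by rewrite -(pmulr_rge0 _ x0); lra.
  have -> : `|e| * (x * y + x * S) = x * `|e * (y + S)|.
    rewrite normrM (ger0_norm (addr_ge0 (ltW y0) S0)); ring.
  rewrite (_ : e * (y + S) = - rho - y * (p + q)); last by rewrite -E; ring.
  rewrite -mulrA -mulrDr ler_wpM2l ?(ltW x0)//.
  rewrite (le_trans (ler_normB _ _))// normrN lerD// normrM (ger0_norm (ltW y0)).
  by rewrite ler_wpM2l ?(ltW y0)// ler_normD.
have Y0 : 0 < x * y by rewrite mulr_gt0.
have w0 : 0 <= x * `|rho| by rewrite mulr_ge0// ltW.
have P0 : 0 <= `|p| + `|q| by rewrite addr_ge0.
have Z0 : 0 < x * y + x * S by lra.
move: H; rewrite -ler_pdivlMr// => /le_trans; apply; rewrite ler_pdivrMr//.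
move: (x * y) (x * S) (x * `|rho|) (`|p| + `|q|) xy xS Y0 w0 P0 {Z0} => Y Z w P; nra.
Qed.

Lemma natr_xi (R : realType) n : (0 < n)%N -> n%:R = (xi n)^- 2 / 6 :> R.
Proof.
move=> n0; have x2 : xi n ^+ 2 != 0 :> R by rewrite expf_neq0// gt_eqF// xi_gt0.
by apply: (mulIf x2); rewrite mulrAC mulVf// mul1r; have := xi_sqr R n n0; lra.
Qed.

Section Main.
Variables (R : realType) (lam t : R) (a b : nat -> R).
Hypothesis a_gt0 : forall n, 0 < a n.+1.
Hypothesis b_gt0 : forall n, 0 < b n.
Hypothesis eq_a : forall n,
  a n.+1 * (b n + a n.+1 + b n.+1 - t / 2) = n.+1%:R / 2.
Hypothesis eq_b : forall n,
  b n * (a n + b n + a n.+1 - t / 2) = (n.+1%:R + lam) / 2.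

Local Notation A := (approx_a R lam t).
Local Notation B := (approx_b R lam t).
Local Notation Bm := (shift_poly R (- 6) B).
Local Notation Ap := (shift_poly R 6 A).

Let ahat n : R := (xi n)^-1 * A.[xi n].
Let bhat n : R := (xi n)^-1 * B.[xi n].

Lemma order_shift_b :
  order_xi 8 (fun n => xi n * bhat n.-1 - Bm.[xi n]).
Proof.
apply: order_xi_eq (@order_shift_poly R (- 6) (fun n => xi n.-1 / xi n) _ _ B _).
- near=> n; have n1 : (1 < n)%N by near: n; exact: nbhs_infty_gt.
  have x0 := xi_gt0 R n (ltnW n1).
  have x1 : 0 < xi n.-1 :> R by apply: xi_gt0; rewrite -subn1 subn_gt0.
  by rewrite invf_div mulrCA mulfV ?gt_eqF// mulr1 /bhat mulrA.
- near=> n; have n1 : (1 < n)%N by near: n; exact: nbhs_infty_gt.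
  by rewrite divr_gt0 ?xi_gt0 ?(ltnW n1)// -subn1 subn_gt0.
- by near=> n; rewrite mulNr; apply: xi_pred; near: n; exact: nbhs_infty_gt.
- exact: size_approx_b.
Unshelve. all: by end_near. Qed.

Lemma order_shift_a :
  order_xi 8 (fun n => xi n * ahat n.+1 - Ap.[xi n]).
Proof.
apply: order_xi_eq (@order_shift_poly R 6 (fun n => xi n.+1 / xi n) _ _ A _).
- near=> n; have n0 : (0 < n)%N by near: n; exact: nbhs_infty_gt.
  have x0 := xi_gt0 R n n0; have x1 := xi_gt0 R n.+1 isT.
  by rewrite invf_div mulrCA mulfV ?gt_eqF// mulr1 /ahat mulrA.
- near=> n; have n0 : (0 < n)%N by near: n; exact: nbhs_infty_gt.
  by rewrite divr_gt0 ?xi_gt0.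
- by near=> n; apply: xi_succ; near: n; exact: nbhs_infty_gt.
- exact: size_approx_a.
Unshelve. all: by end_near. Qed.

Lemma order_horner_sub (p : {poly R}) : order_xi 1 (fun n => p.[xi n] - p`_0).
Proof.
apply: (@order_xi_eq _ _ (fun n => (p - (p`_0)%:P).[xi n])).
  by near=> n; rewrite hornerD hornerN hornerC.
by apply: order_xi_horner_coef => -[|//] _; rewrite coefB coefC subrr.
Unshelve. all: by end_near. Qed.

Lemma approx_coef0 : [/\ A`_0 = 1 / 6, B`_0 = 1 / 6, Bm`_0 = 1 / 6 & Ap`_0 = 1 / 6].
Proof.
have A0 : A`_0 = 1 / 6 by rewrite coef_Poly.
have B0 : B`_0 = 1 / 6 by rewrite coef_Poly.
by split=> //; rewrite coef_Poly /=.
Qed.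

Let Sa n := bhat n.-1 + ahat n + bhat n - t / 2.
Let Sb n := ahat n + bhat n + ahat n.+1 - t / 2.

Lemma near_Sa : \forall n \near \oo, 49 / 100 <= xi n * Sa n.
Proof.
have [A0 B0 C0 _] := approx_coef0.
have H : order_xi 1 (fun n => xi n * Sa n - 1 / 2).
  apply: (@order_xi_eq _ _ (fun n => (xi n * bhat n.-1 - Bm.[xi n]) +
     ((Bm + A + B - (t / 2) *: 'X).[xi n] - (Bm + A + B - (t / 2) *: 'X)`_0))).
    near=> n; have x0 : 0 < xi n :> R by apply: xi_gt0; near: n; exact: near_pos.
    rewrite !(hornerD, hornerN, hornerZ, hornerX) !(coefD, coefN, coefZ, coefX) A0 B0 C0.
    by rewrite /Sa /ahat /(bhat n) /=; field; rewrite gt_eqF.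
  apply: order_xiD; last exact: order_horner_sub.
  by apply: order_xi_leq order_shift_b.
near=> n; have : `|xi n * Sa n - 1 / 2| <= 1 / 100.
  by near: n; apply: order_xi_small => //; lra.
by rewrite ler_norml => /andP[+ _]; move: (xi n * _) => z; lra.
Unshelve. all: by end_near. Qed.

Lemma near_Sb : \forall n \near \oo, 49 / 100 <= xi n * Sb n.
Proof.
have [A0 B0 _ C0] := approx_coef0.
have H : order_xi 1 (fun n => xi n * Sb n - 1 / 2).
  apply: (@order_xi_eq _ _ (fun n => (xi n * ahat n.+1 - Ap.[xi n]) +
     ((A + B + Ap - (t / 2) *: 'X).[xi n] - (A + B + Ap - (t / 2) *: 'X)`_0))).
    near=> n; have x0 : 0 < xi n :> R by apply: xi_gt0; near: n; exact: near_pos.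
    rewrite !(hornerD, hornerN, hornerZ, hornerX) !(coefD, coefN, coefZ, coefX) A0 B0 C0.
    by rewrite /Sb /(ahat n) /bhat /=; field; rewrite gt_eqF.
  apply: order_xiD; last exact: order_horner_sub.
  by apply: order_xi_leq order_shift_a.
near=> n; have : `|xi n * Sb n - 1 / 2| <= 1 / 100.
  by near: n; apply: order_xi_small => //; lra.
by rewrite ler_norml => /andP[+ _]; move: (xi n * _) => z; lra.
Unshelve. all: by end_near. Qed.

Lemma order_residual_a :
  order_xi 8 (fun n => xi n ^+ 2 * (ahat n * Sa n - n%:R / 2)).
Proof.
apply: (@order_xi_eq _ _ (fun n => (residual_a R lam t).[xi n] +
   A.[xi n] * (xi n * bhat n.-1 - Bm.[xi n]))).
  near=> n; have n0 : (0 < n)%N by near: n; exact: near_pos.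
  have x0 := xi_gt0 R n n0.
  rewrite (natr_xi R n n0).
  rewrite /residual_a !(hornerD, hornerM, hornerN, hornerZ, hornerX, hornerC) /Sa.
  by rewrite /ahat /(bhat n); field; rewrite gt_eqF.
apply: order_xiD; first by apply: order_xi_horner_coef; exact: residual_a_coef.
apply: (@order_xiM _ 0 8); [exact: order_xi_horner | exact: order_shift_b].
Unshelve. all: by end_near. Qed.

Lemma order_residual_b :
  order_xi 8 (fun n => xi n ^+ 2 * (bhat n * Sb n - (n.+1%:R + lam) / 2)).
Proof.
apply: (@order_xi_eq _ _ (fun n => (residual_b R lam t).[xi n] +
   B.[xi n] * (xi n * ahat n.+1 - Ap.[xi n]))).
  near=> n; have n0 : (0 < n)%N by near: n; exact: near_pos.
  have x0 := xi_gt0 R n n0; rewrite -[n.+1%:R]natr1.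
  rewrite (natr_xi R n n0).
  rewrite /residual_b !(hornerD, hornerM, hornerN, hornerZ, hornerX, hornerXn, hornerC) /Sb.
  by rewrite /bhat /(ahat n); field; rewrite gt_eqF.
apply: order_xiD; first by apply: order_xi_horner_coef; exact: residual_b_coef.
apply: (@order_xiM _ 0 8); [exact: order_xi_horner | exact: order_shift_a].
Unshelve. all: by end_near. Qed.

Lemma near_t_xi (e : R) : 0 < e -> \forall n \near \oo, `|t / 2 * xi n| <= e.
Proof.
move=> e0; apply: order_xi_small => //; apply: order_xiZ.
exact: (order_xi_xi R 1).
Qed.

(** Without the positive neighbours, the string equation gives
    (xi a)^2 <= 1 / 12 + o(1), and 1 / sqrt 12 < 0.29. *)
Lemma near_a_le : \forall n \near \oo, xi n * a n <= 3 / 10.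
Proof.
near=> n; have n0 : (0 < n)%N by near: n; exact: near_pos.
have x0 := xi_gt0 R n n0; have xE := xi_sqr R n n0.
have tx : `|t / 2 * xi n| <= 1 / 100 by near: n; apply: near_t_xi; lra.
have a0 : 0 < a n by case: (n) n0 => // k _; exact: a_gt0.
have b0 := b_gt0 n; have b1 := b_gt0 n.-1.
have E : a n * (b n.-1 + a n + b n - t / 2) = n%:R / 2 by case: (n) n0 => // k _; exact: eq_a.
rewrite leNgt; apply/negP => H.
have h1 : a n * (a n - t / 2) <= n%:R / 2 by rewrite -E ler_wpM2l ?(ltW a0)//; lra.
have h2 : xi n ^+ 2 * (a n * (a n - t / 2)) <= 1 / 12.
  have -> : 1 / 12 = xi n ^+ 2 * (n%:R / 2) :> R by lra.
  by rewrite ler_wpM2l ?exprn_ge0 ?(ltW x0).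
have h3 : (xi n * a n) * (xi n * a n - t / 2 * xi n) <= 1 / 12 by apply: le_trans h2; lra.
move: tx; rewrite ler_norml => /andP[_]; move: (t / 2 * xi n) (xi n * a n) H h3 => u v *; nra.
Unshelve. all: by end_near. Qed.

Lemma near_b_le : \forall n \near \oo, xi n * b n <= 3 / 10.
Proof.
near=> n; have n0 : (0 < n)%N by near: n; exact: near_pos.
have x0 := xi_gt0 R n n0; have xE := xi_sqr R n n0.
have tx : `|t / 2 * xi n| <= 1 / 100 by near: n; apply: near_t_xi; lra.
have lx : `|(1 + lam) / 2 * xi n ^+ 2| <= 1 / 1000.
  near: n; apply: order_xi_small; first lra.
  by apply: order_xiZ; apply: order_xi_leq (order_xi_xi R 2).
have a0 : 0 < a n by case: (n) n0 => // k _; exact: a_gt0.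
have b0 := b_gt0 n; have a1 := a_gt0 n.
have E := eq_b n.
rewrite leNgt; apply/negP => H.
move: a0 a1 E; move: (a n) (a n.+1) => an an1 a0 a1 E.
have h1 : b n * (b n - t / 2) <= (n.+1%:R + lam) / 2 by rewrite -E ler_wpM2l ?(ltW b0)//; lra.
have h2 : xi n ^+ 2 * (b n * (b n - t / 2)) <= 1 / 12 + (1 + lam) / 2 * xi n ^+ 2.
  have -> : 1 / 12 + (1 + lam) / 2 * xi n ^+ 2 = xi n ^+ 2 * ((n.+1%:R + lam) / 2).
    by rewrite -[n.+1%:R]natr1; lra.
  by rewrite ler_wpM2l ?exprn_ge0 ?(ltW x0).
have h3 : (xi n * b n) * (xi n * b n - t / 2 * xi n) <= 1 / 12 + (1 + lam) / 2 * xi n ^+ 2.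
  by apply: le_trans h2; lra.
move: tx lx; rewrite !ler_norml => /andP[_ + /andP[_]].
move: (t / 2 * xi n) (xi n * b n) ((1 + lam) / 2 * _) H h3 => u v w *; nra.
Unshelve. all: by end_near. Qed.

Let max_error n := Num.max `|a n - ahat n| `|b n - bhat n|.

(** For the larger of the two errors at n, one of the neighbours in its
    recursion has the same index n; moving it to the left turns 2/5 and 2/5
    into (2/5) / (1 - 2/5) = 2/3. *)
Lemma order_max_error : order_xi 7 max_error.
Proof.
apply: order_xi_of_contraction.
- by move=> n; rewrite /max_error le_max normr_ge0.
- have [C1 H1] := order_xi_horner R A; have [C2 H2] := order_xi_horner R B.
  exists (1 + `|C1| + `|C2|); near=> n.
  have n0 : (0 < n)%N by near: n; exact: near_pos.
  have x0 := xi_gt0 R n n0.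
  have a0 : 0 < a n by case: (n) n0 => // k _; exact: a_gt0.
  have h1 : `|A.[xi n]| <= `|C1|.
    by apply: le_trans (ler_norm _); rewrite -[X in _ <= X]mulr1 -(expr0 (xi n)); near: n.
  have h2 : `|B.[xi n]| <= `|C2|.
    by apply: le_trans (ler_norm _); rewrite -[X in _ <= X]mulr1 -(expr0 (xi n)); near: n.
  have h3 : xi n * a n <= 3 / 10 by near: n; exact: near_a_le.
  have h4 : xi n * b n <= 3 / 10 by near: n; exact: near_b_le.
  have g1 : xi n * `|a n - ahat n| <= 1 + `|C1| + `|C2|.
    rewrite -{1}(gtr0_norm x0) -normrM mulrBr mulVKf ?gt_eqF//.
    rewrite (le_trans (ler_normB _ _))// gtr0_norm ?mulr_gt0//.
    by have := normr_ge0 C2; lra.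
  have g2 : xi n * `|b n - bhat n| <= 1 + `|C1| + `|C2|.
    rewrite -{1}(gtr0_norm x0) -normrM mulrBr mulVKf ?gt_eqF//.
    rewrite (le_trans (ler_normB _ _))// gtr0_norm ?mulr_gt0//.
    by have := normr_ge0 C1; lra.
  by rewrite /max_error; case: (lerP `|a n - ahat n| `|b n - bhat n|).
- have [C1 H1] := order_xi_div _ _ _ order_residual_a.
  have [C2 H2] := order_xi_div _ _ _ order_residual_b.
  exists (5 * (`|C1| + `|C2|)); near=> n.
  have n0 : (0 < n)%N by near: n; exact: near_pos.
  have x0 := xi_gt0 R n n0.
  have x7 : 0 <= xi n ^+ 7 :> R by rewrite exprn_ge0// ltW.
  have a0 : 0 < a n by case: (n) n0 => // k _; exact: a_gt0.
  have b0 := b_gt0 n.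
  have h1 : xi n * `|ahat n * Sa n - n%:R / 2| <= `|C1| * xi n ^+ 7.
    apply: le_trans (_ : C1 * xi n ^+ 7 <= _); last by rewrite ler_wpM2r// ler_norm.
    rewrite -[X in X * `|_|](gtr0_norm x0) -normrM.
    rewrite (_ : xi n * _ = (xi n)^-1 * (xi n ^+ 2 * (ahat n * Sa n - n%:R / 2))).
      by near: n.
    by rewrite mulrA expr2 mulKf ?gt_eqF.
  have h2 : xi n * `|bhat n * Sb n - (n.+1%:R + lam) / 2| <= `|C2| * xi n ^+ 7.
    apply: le_trans (_ : C2 * xi n ^+ 7 <= _); last by rewrite ler_wpM2r// ler_norm.
    rewrite -[X in X * `|_|](gtr0_norm x0) -normrM.
    rewrite (_ : xi n * _ = (xi n)^-1 * (xi n ^+ 2 * (bhat n * Sb n - (n.+1%:R + lam) / 2))).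
      by near: n.
    by rewrite mulrA expr2 mulKf ?gt_eqF.
  have Ea : a n * (b n.-1 + a n + b n - t / 2) = n%:R / 2 by case: (n) n0 => // k _; exact: eq_a.
  have ea : `|a n - ahat n| <= 2 / 5 * (`|b n.-1 - bhat n.-1| + `|b n - bhat n|)
      + 3 * (xi n * `|ahat n * Sa n - n%:R / 2|).
    apply: (@one_step_error _ _ (a n) _ _ _ (Sa n)) => //.
    + by near: n; exact: near_a_le.
    + by near: n; exact: near_Sa.
    + by rewrite -Ea /Sa; ring.
  have eb : `|b n - bhat n| <= 2 / 5 * (`|a n - ahat n| + `|a n.+1 - ahat n.+1|)
      + 3 * (xi n * `|bhat n * Sb n - (n.+1%:R + lam) / 2|).
    apply: (@one_step_error _ _ (b n) _ _ _ (Sb n)) => //.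
    + by near: n; exact: near_b_le.
    + by near: n; exact: near_Sb.
    + by rewrite -(eq_b n) /Sb; ring.
  have k1 : `|b n.-1 - bhat n.-1| <= max_error n.-1 by rewrite /max_error le_max lexx orbT.
  have k2 : `|a n.+1 - ahat n.+1| <= max_error n.+1 by rewrite /max_error le_max lexx.
  have k3 : `|a n - ahat n| <= max_error n by rewrite /max_error le_max lexx.
  have k4 : `|b n - bhat n| <= max_error n by rewrite /max_error le_max lexx orbT.
  have m1 : max_error n.-1 <= Num.max (max_error n.-1) (max_error n.+1) by rewrite le_max lexx.
  have m2 : max_error n.+1 <= Num.max (max_error n.-1) (max_error n.+1) by rewrite le_max lexx orbT.
  have C1x : 0 <= `|C1| * xi n ^+ 7 by rewrite mulr_ge0.
  have C2x : 0 <= `|C2| * xi n ^+ 7 by rewrite mulr_ge0.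
  rewrite mulrAC mulrDr mulrDl.
  have : max_error n = `|a n - ahat n| \/ max_error n = `|b n - bhat n|.
    by rewrite /max_error; case: (lerP `|a n - ahat n|) => _; [right|left].
  by move: (max_error n) (Num.max (max_error n.-1) _) k3 k4 m1 m2 => e M k3 k4 m1 m2; case=> ->; lra.
Unshelve. all: by end_near. Qed.

End Main.

(** * The expansions *)

Lemma order_xi_pred (R : realType) k (f : nat -> R) :
  order_xi k f -> order_xi k (fun n => f n.-1).
Proof.
move=> [C fC]; exists (`|C| * (101 / 100) ^+ k).
have fC' : \forall n \near \oo, `|f n.-1| <= C * xi n.-1 ^+ k.
  move: fC => [N _ fC]; exists N.+1 => // n /= Nn; apply: fC => /=.
  by rewrite -ltnS (leq_trans Nn) ?leqSpred.
near=> n; apply: (le_trans (_ : _ <= C * xi n.-1 ^+ k)); first by near: n.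
apply: (le_trans (ler_wpM2r (exprn_ge0 _ (xi_ge0 R _)) (ler_norm C))).
rewrite -mulrA ler_wpM2l// -exprMn lerXn2r ?nnegrE ?mulr_ge0 ?xi_ge0//.
by near: n; exact: xi_pred_le.
Unshelve. all: by end_near. Qed.

Lemma eqaddO_of_order_xi (R : realType) (k : nat) (r : R) (f g : nat -> R) :
  k%:R / 2 = r -> order_xi k (fun n => f n - g n) ->
  f = g +O_\oo (fun n : nat => n%:R `^ (- r) : R).
Proof.
move=> kr [C fC]; apply/eqaddOP.
near=> K; near=> n.
have n0 : (0 < n)%N by near: n; exact: near_pos.
have N0 : 0 < n%:R :> R by rewrite ltr0n.
apply: (le_trans (_ : _ <= C * xi n ^+ k)); first by near: n.
rewrite (ger0_norm (powR_ge0 _ _)).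
have xk : xi n ^+ k <= n%:R `^ (- r) :> R.
  rewrite /xi exprVn powRN lef_pV2 ?posrE ?powR_gt0 ?exprn_gt0 ?sqrtr_gt0 ?mulr_gt0//.
  rewrite -powR12_sqrt ?mulr_ge0// -powR_mulrn ?powR_ge0// -powRrM (mulrC 2^-1) kr.
  by rewrite ge0_ler_powR ?nnegrE -?kr ?mulr_ge0 ?divr_ge0// ler_peMl ?ler1n.
apply: (le_trans (ler_wpM2r (exprn_ge0 _ (xi_ge0 R _)) (_ : C <= K))) => //.
apply: ler_wpM2l => //; near: K; exact: nbhs_pinfty_ge.
Unshelve. all: by end_near. Qed.

Section Main.
Variables (R : realType) (lam t : R) (a b alpha beta : nat -> R).
Hypothesis a_gt0 : forall n, 0 < a n.+1.
Hypothesis b_gt0 : forall n, 0 < b n.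
Hypothesis eq_a : forall n,
  a n.+1 * (b n + a n.+1 + b n.+1 - t / 2) = n.+1%:R / 2.
Hypothesis eq_b : forall n,
  b n * (a n + b n + a n.+1 - t / 2) = (n.+1%:R + lam) / 2.
Hypothesis alphaE : forall n, alpha n = a n + b n.
Hypothesis betaE : forall n, beta n.+1 = a n.+1 * b n.

Local Notation A := (approx_a R lam t).
Local Notation B := (approx_b R lam t).
Local Notation Bm := (shift_poly R (- 6) B).

Let ahat n : R := (xi n)^-1 * A.[xi n].
Let bhat n : R := (xi n)^-1 * B.[xi n].

Lemma order_error_a : order_xi 7 (fun n => a n - ahat n).
Proof.
apply: order_xi_le (order_max_error R lam t a b a_gt0 b_gt0 eq_a eq_b); near=> n.
by rewrite [leRHS]ger0_norm le_max ?normr_ge0// lexx.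
Unshelve. all: by end_near. Qed.

Lemma order_error_b : order_xi 7 (fun n => b n - bhat n).
Proof.
apply: order_xi_le (order_max_error R lam t a b a_gt0 b_gt0 eq_a eq_b); near=> n.
by rewrite [leRHS]ger0_norm le_max ?normr_ge0// lexx orbT.
Unshelve. all: by end_near. Qed.

Lemma alpha_order : order_xi 7 (fun n => alpha n - alpha_expansion lam t n).
Proof.
apply: order_xi_eq (order_xiD _ _ _ _ order_error_a order_error_b); near=> n.
have n0 : (0 < n)%N by near: n; exact: near_pos.
rewrite alphaE alpha_expansionE// -alpha_polyE hornerD /ahat /bhat.
move: A.[xi n] B.[xi n] => An Bn; ring.
Unshelve. all: by end_near. Qed.

(** With hats for the truncated formal solution, a_n b_(n-1) differs from the
    product of the two truncations by errors O(xi^7) times factors O(1 / xi). *)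
Lemma beta_order : order_xi 6 (fun n => beta n - beta_expansion lam t n).
Proof.
have eb := order_xi_pred R 7 _ order_error_b.
have db := order_shift_b R lam t.
have b_bounded : order_xi 0 (fun n => xi n * b n.-1).
  apply: (@order_xi_eq _ _ (fun n => xi n ^+ 1 * (b n.-1 - bhat n.-1) +
      ((xi n * bhat n.-1 - Bm.[xi n]) + Bm.[xi n]))).
    by near=> n; ring.
  apply: order_xiD.
    by apply: (@order_xi_leq _ 0 8) => //; apply: (@order_xiM _ 1 7) => //; exact: order_xi_xi.
  by apply: order_xiD; [apply: order_xi_leq db | exact: order_xi_horner].
have P8 : order_xi 8 (fun n => (A * Bm - beta_poly R lam t).[xi n]
    + A.[xi n] * (xi n * bhat n.-1 - Bm.[xi n])).
  apply: order_xiD; first by apply: order_xi_horner_coef; exact: beta_poly_coef.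
  by apply: (@order_xiM _ 0 8) => //; exact: order_xi_horner.
have ab : order_xi 7 (fun n => A.[xi n] * (b n.-1 - bhat n.-1)
   + (a n - ahat n) * (xi n * b n.-1)).
  apply: order_xiD; first by apply: (@order_xiM _ 0 7) => //; exact: order_xi_horner.
  by apply: (@order_xiM _ 7 0) => //; exact: order_error_a.
have P6 := order_xi_div _ _ _ (order_xi_div _ _ _ P8).
apply: order_xi_eq (order_xiD _ _ _ _ P6 (order_xi_div _ _ _ ab)).
near=> n; have n0 : (0 < n)%N by near: n; exact: near_pos.
have x0 := xi_gt0 R n n0.
have -> : beta n = a n * b n.-1 by case: (n) n0 => // k _; exact: betaE.
rewrite beta_expansionE// !(hornerD, hornerN, hornerM) /ahat.
move: (bhat n.-1) A.[xi n] Bm.[xi n] (beta_poly R lam t).[xi n] => bn An Bn Qn.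
by field; rewrite gt_eqF.
Unshelve. all: by end_near. Qed.

End Main.

Theorem theorem1p6 (R : realType) (lam t : R) (P : nat -> {poly R})
    (h alpha beta : nat -> R)
    (lam_gt0 : 0 < lam)
    (P_ops : monic_orthogonal_polynomials
               (semiclassical_laguerre_weight lam t) P h)
    (P_rec : recurrence_coefficients P alpha beta) :
  (alpha = alpha_expansion lam t +O_\oo (fun n : nat => n%:R `^ (- (7 / 2))))
  /\ (beta = beta_expansion lam t +O_\oo (fun n : nat => n%:R `^ (- 3))).
Proof.
have [P_deg P_orth] := P_ops; have [P0 P_rec0 P_recS] := P_rec.
pose L := moment R lam t.
have LD p q : L (p + q) = L p + L q by exact: momentD.
have LZ c p : L (c *: p) = c * L p by exact: momentZ.
have L_gt0 (p : {poly R}) : p != 0 -> (forall x, 0 < x -> 0 <= p.[x]) -> 0 < L p.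
  exact: moment_gt0.
have L_pearson p : L (pearson R lam t p) = 0 by exact: moment_pearson.
have L_orth m n : L (P m * P n) = if m == n then h n else 0.
  rewrite /L /moment /Rintegral; under eq_integral do rewrite hornerM.
  by rewrite P_orth.
have P_monic n : P n \is monic := (P_deg n).1.
have size_P n : size (P n) = n.+1 := (P_deg n).2.
pose a := qd_coef R P beta; pose b := kernel_coef R P.
have a_gt0 n : 0 < a n.+1 by apply: (qd_coef_gt0 R L LD LZ L_gt0 P h alpha beta).
have b_gt0 n : 0 < b n by apply: (kernel_coef_gt0 R L LD LZ L_gt0 P h).
have eq_a := string_eq_a R lam t L LD LZ L_gt0 L_pearson P h alpha beta
  P_monic size_P L_orth P0 P_rec0 P_recS.
have eq_b := string_eq_b R lam t L LD LZ L_gt0 L_pearson P h alpha beta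
  P_monic size_P L_orth P0 P_rec0 P_recS.
have alphaE n : alpha n = a n + b n by apply: (alpha_sum R L LD LZ L_gt0 P h alpha beta).
have betaE n : beta n.+1 = a n.+1 * b n by apply: (beta_factor R L LD LZ L_gt0 P h).
split.
  apply: (@eqaddO_of_order_xi R 7) => //.
  exact: (alpha_order R lam t a b alpha a_gt0 b_gt0 eq_a eq_b alphaE).
apply: (@eqaddO_of_order_xi R 6); first by field.
exact: (beta_order R lam t a b beta a_gt0 b_gt0 eq_a eq_b betaE).
Qed.
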